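(* Let $M^{n}$ be a non-minimal $n$-dimensional integral $\mathcal{C}$-parallel submanifold of a Sasakian space form $N^{2n+1}(c)$. Then $M$ is proper-biharmonic if and only if $c>\frac{7-3n}{n+3}$ and $$ \operatorname{trace} B(\cdot,A_{H}\cdot)=\frac{c(n+3)+3n-7}{4}H. $$
   Context: Everything is smooth; manifolds are connected. A contact metric structure on $N^{2n+1}$ is $(\varphi,\xi,\eta,g)$ with $\varphi$ a $(1,1)$-tensor field, $\xi$ a vector field, $\eta$ a 1-form, $g$ a Riemannian metric such that $\varphi^2=-I+\eta\otimes\xi$, $\eta(\xi)=1$, $g(\varphi U,\varphi V)=g(U,V)-\eta(U)\eta(V)$, $g(U,\varphi V)=d\eta(U,V)$. It is Sasakian if $(\nabla^N_U\varphi)(V)=g(U,V)\xi-\eta(V)U$ for all vector fields $U,V$; then $\nabla^N_U\xi=-\varphi U$. The $\varphi$-sectional curvature is the sectional curvature of the planes spanned by $U,\varphi U$ with $U$ a unit vector orthogonal to $\xi$; a Sasakian space form $N(c)$ is a Sasakian manifold with constant $\varphi$-sectional curvature $c$. An integral submanifold $M$ of $N$ is a submanifold (with induced metric) with $\eta(X)=0$ for all $X$ tangent to $M$. $B$ is its second fundamental form, $A$ its shape operator, $H=\frac1n\operatorname{trace}B$ its mean curvature vector field, $\nabla^\perp$ the normal connection; $\operatorname{trace}B(\cdot,A_H\cdot)=\sum_iB(X_i,A_HX_i)$ for an orthonormal frame $\{X_i\}$ on $M$. $M$ is integral $\mathcal{C}$-parallel if it is integral and $\nabla^\perp B$ is parallel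 to $\xi$, i.e. $(\nabla^\perp B)(X,Y,Z)=g(\varphi X,B(Y,Z))\xi$ for all $X,Y,Z$ tangent to $M$, where $(\nabla^{\perp}B)(X,Y,Z)=\nabla^{\perp}_{X}B(Y,Z)-B(\nabla_{X}Y,Z)-B(Y,\nabla_{X}Z)$. A map $\psi:(M,g)\to(N,h)$ is biharmonic if it is a critical point of the bienergy $E_2(\psi)=\frac12\int_M|\tau(\psi)|^2v_g$, $\tau(\psi)=\operatorname{trace}\nabla d\psi$; equivalently $\tau_2(\psi)=-\Delta\tau(\psi)-\operatorname{trace}R^N(d\psi,\tau(\psi))d\psi=0$, with $\Delta=-\operatorname{trace}\nabla^2$ the rough Laplacian. It is proper-biharmonic if biharmonic and not harmonic. A submanifold is (proper-)biharmonic if its inclusion map is. *)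

(* Defs.v *)
(* Smooth Riemannian and Sasakian geometry over R : realType (MathComp-Analysis).

   Tensors on an m-dimensional manifold are given by their components in the
   charts of an atlas, together with the transformation law on overlaps.
   A tangent vector in a chart is a row vector u : 'rV_m, a one-form a column
   vector w (w(u) = u *m w), an endomorphism a matrix F acting by u *m F, and a
   metric a matrix G with G(u, v) = u *m G *m v^T.  The push-forward of u by a
   map f at x is the directional derivative 'D_u f x. *)
From mathcomp Require Import all_boot all_order all_algebra.
From mathcomp Require Import all_classical all_reals all_analysis.

Set Implicit Arguments.
Unset Strict Implicit.
Unset Printing Implicit Defensive.

Import Order.TTheory GRing.Theory Num.Theory.
Import numFieldNormedType.Exports.

Local Open Scope classical_set_scope.
Local Open Scope ring_scope.

(* For U open this is the usual C^infty regularity on U: all iterated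
   directional derivatives exist and are Frechet differentiable on U. *)
Definition smooth_on (R : realType) (m : nat) (W : normedModType R)
    (U : set 'rV[R]_m) (f : 'rV[R]_m -> W) : Prop :=
  forall (s : seq 'rV[R]_m) (x : 'rV[R]_m), U x ->
    differentiable (foldr (fun v h => 'D_v h) f s) x.

Record manifold (R : realType) (m : nat) := Manifold {
  points :> topologicalType;
  atlas : Type;
  dom : atlas -> set points;
  chart : atlas -> points -> 'rV[R]_m;
  param : atlas -> 'rV[R]_m -> points;
  dom_open : forall a, open (dom a);
  img_open : forall a, open (chart a @` dom a);
  chartK : forall a p, dom a p -> param a (chart a p) = p;
  chart_continuous : forall a p, dom a p -> {for p, continuous (chart a)};
  param_continuous : forall a x, (chart a @` dom a) x ->
    {for x, continuous (param a)};
  dom_cover : forall p, exists a, dom a p;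
  transition_smooth : forall a b,
    smooth_on [set x | (chart a @` dom a) x /\ dom b (param a x)]
              (chart b \o param a);
  manifold_hausdorff : hausdorff_space points;
  manifold_second_countable : @second_countable points;
  manifold_connected : connected [set: points] }.

Definition img (R : realType) (m : nat) (M : manifold R m) (a : atlas M) :
    set 'rV[R]_m := chart a @` dom a.

Definition overlap (R : realType) (m : nat) (M : manifold R m)
    (a b : atlas M) : set 'rV[R]_m :=
  [set x | img a x /\ dom b (param a x)].

Definition transition (R : realType) (m : nat) (M : manifold R m)
    (a b : atlas M) : 'rV[R]_m -> 'rV[R]_m := chart b \o param a.

Section MapInCharts.
Variables (R : realType) (n m : nat) (M : manifold R n) (N : manifold R m).
Variable psi : M -> N.

Definition loc_dom (a : atlas M) (b : atlas N) : set 'rV[R]_n :=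
  [set x | img a x /\ dom b (psi (param a x))].

Definition loc (a : atlas M) (b : atlas N) : 'rV[R]_n -> 'rV[R]_m :=
  chart b \o psi \o param a.

Definition smooth_map : Prop :=
  continuous psi /\ forall a b, smooth_on (loc_dom a b) (loc a b).

End MapInCharts.

Section Tensors.
Variables (R : realType) (m : nat).

Definition inner (G : 'M[R]_m) (u v : 'rV[R]_m) : R := (u *m G *m v^T) 0 0.

Definition pairing (w : 'cV[R]_m) (u : 'rV[R]_m) : R := (u *m w) 0 0.

Variable M : manifold R m.

Record metric := Metric {
  metric_at :> atlas M -> 'rV[R]_m -> 'M[R]_m;
  metric_smooth : forall a, smooth_on (img a) (metric_at a);
  metric_sym : forall a x u v, img a x ->
    inner (metric_at a x) u v = inner (metric_at a x) v u;
  metric_pos : forall a x u, img a x -> u != 0 ->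
    0 < inner (metric_at a x) u u;
  metric_transform : forall a b x u v, overlap a b x ->
    inner (metric_at b (transition a b x))
          ('D_u (transition a b) x) ('D_v (transition a b) x)
    = inner (metric_at a x) u v }.

Record vector_field := VectorField {
  vector_at :> atlas M -> 'rV[R]_m -> 'rV[R]_m;
  vector_smooth : forall a, smooth_on (img a) (vector_at a);
  vector_transform : forall a b x, overlap a b x ->
    'D_(vector_at a x) (transition a b) x = vector_at b (transition a b x) }.

Record one_form := OneForm {
  form_at :> atlas M -> 'rV[R]_m -> 'cV[R]_m;
  form_smooth : forall a, smooth_on (img a) (form_at a);
  form_transform : forall a b x u, overlap a b x ->
    pairing (form_at b (transition a b x)) ('D_u (transition a b) x)
    = pairing (form_at a x) u }.

Record endo_field := EndoField {
  endo_at :> atlas M -> 'rV[R]_m -> 'M[R]_m;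
  endo_smooth : forall a, smooth_on (img a) (endo_at a);
  endo_transform : forall a b x u, overlap a b x ->
    'D_u (transition a b) x *m endo_at b (transition a b x)
    = 'D_(u *m endo_at a x) (transition a b) x }.

End Tensors.

Section ChartGeometry.
Variables (R : realType) (m : nat).

Definition basis_vec (k : 'I_m) : 'rV[R]_m := delta_mx 0 k.

(* The vector w with G(w, e_k) = l_k for all k. *)
Definition raise (G : 'M[R]_m) (l : 'rV[R]_m) : 'rV[R]_m := l *m invmx G.

(* T_ij G^ij, that is \sum_i T(X_i, X_i) for any G-orthonormal basis (X_i). *)
Definition mtrace (W : lmodType R) (G : 'M[R]_m)
    (T : 'rV[R]_m -> 'rV[R]_m -> W) : W :=
  \sum_(i < m) \sum_(j < m) invmx G i j *: T (basis_vec i) (basis_vec j).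

(* The convention with the factor 1/2, for which d eta (U, V) = g(U, phi V)
   agrees with nabla_U xi = - phi U on a Sasakian manifold. *)
Definition ext_deriv (w : 'rV[R]_m -> 'cV[R]_m) (x u v : 'rV[R]_m) : R :=
  2^-1 * (pairing ('D_u w x) v - pairing ('D_v w x) u).

Variable G : 'rV[R]_m -> 'M[R]_m.

(* The vector Gamma^k_ij u^i v^j. *)
Definition christoffel (x u v : 'rV[R]_m) : 'rV[R]_m :=
  raise (G x) (\row_k (2^-1 * (inner ('D_u G x) v (basis_vec k)
                              + inner ('D_v G x) u (basis_vec k)
                              - inner ('D_(basis_vec k) G x) u v))).

(* Levi-Civita connection of G. *)
Definition cov (u : 'rV[R]_m) (V : 'rV[R]_m -> 'rV[R]_m) (x : 'rV[R]_m) :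
    'rV[R]_m :=
  'D_u V x + christoffel x u (V x).

(* R(u, v) w = [nabla_u, nabla_v] w - nabla_[u, v] w, evaluated on the vector
   fields with constant components u, v, w, for which [u, v] = 0. *)
Definition curv (x u v w : 'rV[R]_m) : 'rV[R]_m :=
  cov u (cov v (cst w)) x - cov v (cov u (cst w)) x.

Definition sectional (x u v : 'rV[R]_m) : R :=
  inner (G x) (curv x u v v) u
  / (inner (G x) u u * inner (G x) v v - inner (G x) u v ^+ 2).

End ChartGeometry.

(* A map f between chart domains with metrics g and h; sections of the pull-back
   bundle f^* TN are functions 'rV_n -> 'rV_m. *)
Section MapGeometry.
Variables (R : realType) (n m : nat).
Variables (g : 'rV[R]_n -> 'M[R]_n) (h : 'rV[R]_m -> 'M[R]_m).
Variable f : 'rV[R]_n -> 'rV[R]_m.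
Implicit Types (u v x : 'rV[R]_n) (w : 'rV[R]_m) (X Y : 'rV[R]_n -> 'rV[R]_n)
  (V : 'rV[R]_n -> 'rV[R]_m).

(* Pull-back by f of the Levi-Civita connection of h. *)
Definition cov_along u V x : 'rV[R]_m :=
  'D_u V x + christoffel h (f x) ('D_u f x) (V x).

(* (nabla d f)(u, v) *)
Definition hessian_map u v x : 'rV[R]_m :=
  cov_along u ('D_v f) x - 'D_(cov g u (cst v) x) f x.

Definition tension x : 'rV[R]_m :=
  mtrace (g x) (fun u v => hessian_map u v x).

(* (nabla^2 V)(u, v) *)
Definition cov2_along u v V x : 'rV[R]_m :=
  cov_along u (cov_along v V) x - cov_along (cov g u (cst v) x) V x.

Definition rough_laplacian V x : 'rV[R]_m :=
  - mtrace (g x) (fun u v => cov2_along u v V x).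

Definition bitension x : 'rV[R]_m :=
  - rough_laplacian tension x
  - mtrace (g x)
      (fun u v => curv h (f x) ('D_u f x) (tension x) ('D_v f x)).

(* From here on the definitions are meaningful when f is isometric. *)
Definition tangential_part x w : 'rV[R]_n :=
  raise (g x) (\row_k inner (h (f x)) w ('D_(basis_vec R k) f x)).

Definition normal_part x w : 'rV[R]_m := w - 'D_(tangential_part x w) f x.

Definition second_form u v x : 'rV[R]_m := normal_part x (cov_along u ('D_v f) x).

(* A_w u, defined by g(A_w u, v) = h(B(u, v), w). *)
Definition shape_op x w u : 'rV[R]_n :=
  raise (g x) (\row_k inner (h (f x)) (second_form u (basis_vec R k) x) w).

Definition mean_curvature x : 'rV[R]_m :=
  n%:R^-1 *: mtrace (g x) (fun u v => second_form u v x).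

Definition normal_conn u V x : 'rV[R]_m := normal_part x (cov_along u V x).

(* (nabla^perp B)(u, X, Y) *)
Definition cov_second_form u X Y x : 'rV[R]_m :=
  normal_conn u (fun y => second_form (X y) (Y y) y) x
  - second_form (cov g u X x) (Y x) x - second_form (X x) (cov g u Y x) x.

End MapGeometry.

Section Maps.
Variables (R : realType) (n m : nat) (M : manifold R n) (N : manifold R m).
Variables (g : metric M) (h : metric N) (psi : M -> N).

Definition harmonic : Prop :=
  smooth_map psi /\
  forall a b x, loc_dom psi a b x -> tension (g a) (h b) (loc psi a b) x = 0.

Definition biharmonic : Prop :=
  smooth_map psi /\
  forall a b x, loc_dom psi a b x ->
    bitension (g a) (h b) (loc psi a b) x = 0.

Definition proper_biharmonic : Prop := biharmonic /\ ~ harmonic.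

(* (M, g) is a submanifold of (N, h) with the induced metric, psi being the
   inclusion. *)
Definition isometric_immersion : Prop :=
  smooth_map psi /\
  forall a b x u v, loc_dom psi a b x ->
    inner (h b (loc psi a b x)) ('D_u (loc psi a b) x) ('D_v (loc psi a b) x)
    = inner (g a x) u v.

Definition minimal : Prop :=
  forall a b x, loc_dom psi a b x ->
    mean_curvature (g a) (h b) (loc psi a b) x = 0.

End Maps.

Record contact_metric (R : realType) (n : nat) (N : manifold R n.*2.+1)
    (g : metric N) := ContactMetric {
  phi : endo_field N;
  xi : vector_field N;
  eta : one_form N;
  phi_sqr : forall a x u, img a x ->
    u *m phi a x *m phi a x = - u + pairing (eta a x) u *: xi a x;
  eta_xi : forall a x, img a x -> pairing (eta a x) (xi a x) = 1;
  metric_phi : forall a x u v, img a x ->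
    inner (g a x) (u *m phi a x) (v *m phi a x)
    = inner (g a x) u v - pairing (eta a x) u * pairing (eta a x) v;
  contact_eta : forall a x u v, img a x ->
    inner (g a x) u (v *m phi a x) = ext_deriv (eta a) x u v }.

Section Contact.
Variables (R : realType) (n : nat) (N : manifold R n.*2.+1) (h : metric N).
Variable S : contact_metric h.

(* V ranges over the vector fields on the domain of a chart. *)
Definition sasakian : Prop :=
  forall a (V : 'rV[R]_(n.*2.+1) -> 'rV[R]_(n.*2.+1)), smooth_on (img a) V ->
  forall x u, img a x ->
    cov (h a) u (fun y => V y *m phi S a y) x - cov (h a) u V x *m phi S a x
    = inner (h a x) u (V x) *: xi S a x - pairing (eta S a x) (V x) *: u.

Definition sasakian_space_form (c : R) : Prop :=
  sasakian /\
  forall a x u, img a x ->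
    inner (h a x) u u = 1 -> inner (h a x) u (xi S a x) = 0 ->
    sectional (h a) x u (u *m phi S a x) = c.

Variables (M : manifold R n) (g : metric M) (psi : M -> N).

Definition integral_submanifold : Prop :=
  isometric_immersion g h psi /\
  forall a b x u, loc_dom psi a b x ->
    pairing (eta S b (loc psi a b x)) ('D_u (loc psi a b) x) = 0.

Definition integral_C_parallel : Prop :=
  integral_submanifold /\
  forall a b (X Y : 'rV[R]_n -> 'rV[R]_n),
  smooth_on (img a) X -> smooth_on (img a) Y ->
  forall x u, loc_dom psi a b x ->
    let f := loc psi a b in
    cov_second_form (g a) (h b) f u X Y x
    = inner (h b (f x)) ('D_u f x *m phi S b (f x))
            (second_form (g a) (h b) f (X x) (Y x) x) *: xi S b (f x).

End Contact.

(* Main.v *)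
Require Import Defs.
From mathcomp Require Import all_boot all_order all_algebra.
From mathcomp Require Import all_classical all_reals all_analysis.
From mathcomp Require Import ring lra.

(* The tension field of M is n H.  Since nabla^perp B is parallel to xi, so is
   nabla^perp H: nabla_u H = - df (A_H u) + g(phi df u, H) xi, and A_H is parallel.
   Differentiating once more and tracing, the tangential terms and the xi terms
   vanish, and trace nabla^2 H = - trace B(., A_H .) - H; the last term comes from
   nabla xi = - phi and from H being a section of phi(TM), because TM, phi(TM) and xi
   span TN for dimensional reasons.  A polarization in the manner of Kaehler geometry
   determines trace R(df, H) df from the phi-sectional curvature.  Together
     tau_2 = n (k H - trace B(., A_H .)),   k = (c (n + 3) + 3 n - 7) / 4,
   which gives the equation; pairing it with H where H <> 0 gives k > 0.

   In a chart everything is a matrix: [conn h a u x] is w |-> Gamma(u, w), the curvature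
   [riem h a u v x] is w |-> R(u, v) w, and along f the connection of N pulls back to
   [conn_along], all acting on row vectors from the right. *)

Set Implicit Arguments.
Unset Strict Implicit.
Unset Printing Implicit Defensive.

Import Order.TTheory GRing.Theory Num.Theory.
Import numFieldNormedType.Exports.
Local Open Scope classical_set_scope.
Local Open Scope ring_scope.

(** * Matrix-valued differential calculus *)

(** The curvature enters only under a trace, so only R(u, H) w + R(w, H) u is needed. The Kaehler
    argument cannot be run on R itself, because R(u, v) does not commute with phi on ker eta. The
    commutator is however a fixed expression in g and phi, forced by the symmetry of the second
    derivatives of phi, and the model curvature tensor has the same one. Hence R minus the model is
    of Kaehler type on ker eta, with vanishing holomorphic sectional curvature, and polarization
    applies to this difference.

    The constant splits as k = (c + 3) n / 4 + 3 (c - 1) / 4 - 1: the trace of the metric part of R,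
    its phi part once H is expanded in the frame phi df(e_i), and the term - H of trace nabla^2 H.

    A technical obstacle runs through the file: fields in a chart are total functions on row
    vectors, and the identities between them hold only on an open set. Each derivative is therefore
    taken after replacing the field near the point by an explicit matrix formula, whose
    differentiability has to be established separately. *)

Section Calculus.
Variables (R : realType) (V : normedModType R).
Implicit Types (x u v : V).

Lemma bigsum_fctE (W : normedModType R) I (r : seq I) (P : pred I) (F : I -> V -> W) :
  (fun y => \sum_(i <- r | P i) F i y) = \sum_(i <- r | P i) F i.
Proof. by apply/funext => y; rewrite fct_sumE. Qed.

Lemma differentiable_bigsum (W : normedModType R) I (r : seq I) (P : pred I)
    (F : I -> V -> W) x : (forall i, P i -> differentiable (F i) x) ->
  differentiable (fun y => \sum_(i <- r | P i) F i y) x.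
Proof.
move=> dF; rewrite bigsum_fctE.
apply: (big_ind (fun f => differentiable f x)); last exact: dF.
  exact: differentiable_cst.
by move=> f g; exact: differentiableD.
Qed.

Lemma derive_bigsum (W : normedModType R) I (r : seq I) (P : pred I)
    (F : I -> V -> W) x v : (forall i, P i -> differentiable (F i) x) ->
  'D_v (fun y => \sum_(i <- r | P i) F i y) x = \sum_(i <- r | P i) 'D_v (F i) x.
Proof.
move=> dF; rewrite bigsum_fctE.
pose K (f : V -> W) w := differentiable f x /\ 'D_v f x = w.
suff [] : K (\sum_(i <- r | P i) F i) (\sum_(i <- r | P i) 'D_v (F i) x) by [].
apply: (big_ind2 K) => [|f f' g g' [df <-] [dg <-]|i Pi].
- by split; [exact: differentiable_cst|exact: derive_cst].
- by split; [exact: differentiableD|rewrite deriveD//; exact: diff_derivable].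
- by split=> //; exact: dF.
Qed.

Lemma differentiable_mx p q (F : V -> 'M[R]_(p, q)) x :
  (forall i j, differentiable (fun y => F y i j) x) -> differentiable F x.
Proof.
move=> dF.
have -> : F = fun y => \sum_(i < p) \sum_(j < q) F y i j *: delta_mx i j.
  by apply/funext => y; rewrite {1}[F y]matrix_sum_delta.
do 2!apply: differentiable_bigsum => ? _.
exact: differentiableZl.
Qed.

Lemma differentiable_entry p q (F : V -> 'M[R]_(p, q)) x i j :
  differentiable F x -> differentiable (fun y => F y i j) x.
Proof.
move=> dF; apply: (@differentiable_comp _ _ _ _ F (fun N => N i j)) => //.
exact: differentiable_coord.
Qed.

Lemma derive_entry p q (F : V -> 'M[R]_(p, q)) x v i j :
  differentiable F x -> 'D_v (fun y => F y i j) x = 'D_v F x i j.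
Proof. by move=> dF; rewrite derive_mx ?mxE//; exact: diff_derivable. Qed.

Lemma differentiable_bigprod I (r : seq I) (F : I -> V -> R) x :
  (forall i, differentiable (F i) x) ->
  differentiable (fun y => \prod_(i <- r) F i y) x.
Proof.
move=> dF; elim: r => [|i r IH].
  by under eq_fun do rewrite big_nil; exact: differentiable_cst.
under eq_fun do rewrite big_cons.
exact: differentiableM.
Qed.

Lemma differentiable_add (W : normedModType R) (F G : V -> W) x :
  differentiable F x -> differentiable G x ->
  differentiable (fun y => F y + G y) x.
Proof. exact: differentiableD. Qed.

Lemma differentiable_sub (W : normedModType R) (F G : V -> W) x :
  differentiable F x -> differentiable G x ->
  differentiable (fun y => F y - G y) x.
Proof. exact: differentiableB. Qed.

Lemma derive_mul (F G : V -> R) x v :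
  differentiable F x -> differentiable G x ->
  'D_v (fun y => F y * G y) x = 'D_v F x * G x + F x * 'D_v G x.
Proof.
move=> dF dG; rewrite (@deriveM _ _ F G); [|exact: diff_derivable..].
by rewrite /GRing.scale /=; ring.
Qed.

Lemma differentiable_mulmx p q r (F : V -> 'M[R]_(p, q)) (G : V -> 'M[R]_(q, r)) x :
  differentiable F x -> differentiable G x ->
  differentiable (fun y => F y *m G y) x.
Proof.
move=> dF dG; apply: differentiable_mx => i j.
under eq_fun do rewrite mxE.
apply: differentiable_bigsum => k _.
by apply: differentiableM; exact: differentiable_entry.
Qed.

Lemma derive_mulmx p q r (F : V -> 'M[R]_(p, q)) (G : V -> 'M[R]_(q, r)) x v :
  differentiable F x -> differentiable G x ->
  'D_v (fun y => F y *m G y) x = 'D_v F x *m G x + F x *m 'D_v G x.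
Proof.
move=> dF dG; apply/matrixP => i j.
rewrite -derive_entry; last exact: differentiable_mulmx.
under eq_fun do rewrite mxE.
rewrite derive_bigsum; last first.
  by move=> k _; apply: differentiableM; exact: differentiable_entry.
rewrite 3!mxE -big_split; apply: eq_bigr => k _ /=.
by rewrite derive_mul ?derive_entry//; exact: differentiable_entry.
Qed.

Lemma differentiable_trmx p q (F : V -> 'M[R]_(p, q)) x :
  differentiable F x -> differentiable (fun y => (F y)^T) x.
Proof.
move=> dF; apply: differentiable_mx => i j.
by under eq_fun do rewrite mxE; exact: differentiable_entry.
Qed.

Lemma derive_trmx p q (F : V -> 'M[R]_(p, q)) x v :
  differentiable F x -> 'D_v (fun y => (F y)^T) x = ('D_v F x)^T.
Proof.
move=> dF; apply/matrixP => i j.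
rewrite -derive_entry; last exact: differentiable_trmx.
by under eq_fun do rewrite mxE; rewrite derive_entry// mxE.
Qed.

Lemma differentiable_det p (F : V -> 'M[R]_p) x :
  differentiable F x -> differentiable (fun y => \det (F y)) x.
Proof.
move=> dF; apply: differentiable_bigsum => s _.
apply: differentiableM; first exact: differentiable_cst.
by apply: differentiable_bigprod => i; exact: differentiable_entry.
Qed.

Lemma differentiable_adj p (F : V -> 'M[R]_p) x :
  differentiable F x -> differentiable (fun y => \adj (F y)) x.
Proof.
move=> dF; apply: differentiable_mx => i j.
under eq_fun do rewrite mxE.
apply: differentiableM; first exact: differentiable_cst.
apply: differentiable_det; apply: differentiable_mx => k l.
by under eq_fun do rewrite !mxE; exact: differentiable_entry.
Qed.

Lemma derive_near (W : normedModType R) (F G : V -> W) (U : set V) x v :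
  open U -> U x -> (forall y, U y -> F y = G y) -> 'D_v F x = 'D_v G x.
Proof.
by move=> oU Ux FG; apply: near_eq_derive; apply: filterS FG _; exact: open_nbhs_nbhs.
Qed.

(** The remainder of the expansion of [Z] at [x] vanishes near 0, so the zero map serves as
    differential. [differentiable_on_eq] reduces to this case with [Z = F - G]. *)
Lemma differentiable_near0 (W : normedModType R) (Z : V -> W) x :
  (\near x, Z x = 0) -> differentiable Z x.
Proof.
move=> Z0.
have c0 : continuous (0 : V -> W) by exact: cst_continuous.
have Zo : Z \o shift x = cst (Z x) + \0 +o_ 0 id.
  apply/eqaddoP => e e0.
  have : \forall h \near 0, Z (h + x) = 0.
    by move: Z0; rewrite (near_shift 0) subr0.
  apply: filterS => h Zh.
  have -> : (Z \o shift x - (cst (Z x) + \0)) h = Z (h + x) - (Z x + 0) by [].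
  by rewrite Zh (nbhs_singleton Z0) addr0 subrr normr0 mulr_ge0// ltW.
by apply/diff_locallyP; rewrite (diff_unique c0 Zo).
Qed.

(** Needed for fields such as [mean_curvature], which agree with a computable formula only on the
    domain of the chart. *)
Lemma differentiable_on_eq (W : normedModType R) (F G : V -> W) (U : set V) x :
  open U -> U x -> (forall y, U y -> F y = G y) ->
  differentiable G x -> differentiable F x.
Proof.
move=> oU Ux FG dG; rewrite -(subrK G F); apply: differentiableD; last exact: dG.
apply: differentiable_near0.
have : nbhs x U by exact: open_nbhs_nbhs.
by apply: filterS => y Uy /=; rewrite -[LHS]/(F y - G y) FG// subrr.
Qed.

(** Off the invertible matrices [invmx] is the identity, so Cramer's formula replaces it only on the
    open set [U]. *)
Lemma differentiable_invmx p (F : V -> 'M[R]_p) (U : set V) x :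
  open U -> U x -> (forall y, U y -> F y \in unitmx) ->
  differentiable F x -> differentiable (fun y => invmx (F y)) x.
Proof.
move=> oU Ux uF dF.
apply: (differentiable_on_eq (G := fun y => (\det (F y))^-1 *: \adj (F y)) oU Ux).
  by move=> y Uy; rewrite /invmx uF.
apply: differentiable_mx => i j.
under eq_fun do rewrite mxE.
apply: differentiableM; last exact/differentiable_entry/differentiable_adj.
apply: differentiableV; first exact: differentiable_det.
by have := uF _ Ux; rewrite unitmxE unitfE.
Qed.

Lemma derive_comp (V' W : normedModType R) (F : V -> V') (G : V' -> W) x v :
  differentiable F x -> differentiable G (F x) ->
  'D_v (fun y => G (F y)) x = 'D_('D_v F x) G (F x).
Proof.
move=> dF dG; rewrite deriveE; last exact: (differentiable_comp dF dG).
by rewrite (diff_comp dF dG) /= -!deriveE.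
Qed.

Lemma derive_dir_sum (W : normedModType R) (F : V -> W) x I (r : seq I)
    (P : pred I) (a : I -> R) (v : I -> V) : differentiable F x ->
  'D_(\sum_(i <- r | P i) a i *: v i) F x
  = \sum_(i <- r | P i) a i *: 'D_(v i) F x.
Proof.
move=> dF; rewrite deriveE// linear_sum; apply: eq_bigr => i _.
by rewrite linearZ deriveE.
Qed.

Lemma derive_add (W : normedModType R) (F G : V -> W) x v :
  differentiable F x -> differentiable G x ->
  'D_v (fun y => F y + G y) x = 'D_v F x + 'D_v G x.
Proof. by move=> dF dG; apply: deriveD; exact: diff_derivable. Qed.

Lemma derive_sub (W : normedModType R) (F G : V -> W) x v :
  differentiable F x -> differentiable G x ->
  'D_v (fun y => F y - G y) x = 'D_v F x - 'D_v G x.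
Proof. by move=> dF dG; apply: deriveB; exact: diff_derivable. Qed.

Lemma derive_scalel (W : normedModType R) (a : V -> R) (w : W) x v :
  differentiable a x -> 'D_v (fun y => a y *: w) x = 'D_v a x *: w.
Proof.
move=> da; rewrite deriveE; last exact: differentiableZl.
by rewrite diffZl// deriveE.
Qed.

End Calculus.

(** * Symmetry of second derivatives *)

Section Schwarz.
Variables (R : realType) (V : normedModType R).
Implicit Types (x u v p : V) (U : set V).

Lemma is_derive_line (W : normedModType R) (F : V -> W) p v (t : R) :
  differentiable F (p + t *: v) ->
  is_derive t 1 (fun s : R => F (p + s *: v)) ('D_v F (p + t *: v)).
Proof.
move=> dF.
have dl : differentiable (fun s : R => p + s *: v) t.
  by apply: (@differentiable_add _ _ _ (cst p) (fun s : R => s *: v));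
    [exact: differentiable_cst|exact: differentiableZl].
have dc : differentiable (fun s : R => F (p + s *: v)) t.
  exact: (differentiable_comp dl dF).
split; first exact: diff_derivable.
rewrite (@derive_comp _ _ _ _ (fun s : R => p + s *: v) F)//; congr ('D__ F _).
rewrite (@derive_add _ _ _ (cst p) (fun s : R => s *: v));
  [|exact: differentiable_cst|exact: differentiableZl].
by rewrite derive_cst add0r (@derive_scalel _ _ _ id)// derive_id scale1r.
Qed.

Lemma MVT_line (F : V -> R) p v (h : R) : 0 < h ->
  (forall t, 0 <= t <= h -> differentiable F (p + t *: v)) ->
  exists2 t, 0 <= t <= h & F (p + h *: v) - F p = 'D_v F (p + t *: v) * h.
Proof.
move=> h0 dF.
have [||t] := @MVT R (fun s => F (p + s *: v)) (fun s => 'D_v F (p + s *: v)) 0 h h0.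
- move=> t; rewrite in_itv /= => /andP[t0 th].
  by apply: is_derive_line; apply: dF; rewrite !ltW.
- apply: derivable_within_continuous => t; rewrite in_itv /= => th.
  by have [] := is_derive_line (dF _ th).
rewrite in_itv /= scale0r addr0 subr0 => /andP[t0 th] ->.
by exists t => //; rewrite !ltW.
Qed.

(* Both mixed derivatives are limits of the same second difference quotient. *)
Lemma second_difference (F : V -> R) x u v (h : R) : 0 < h ->
  (forall s t : R, 0 <= s <= h -> 0 <= t <= h ->
    differentiable F (x + s *: u + t *: v) /\
    differentiable ('D_u F) (x + s *: u + t *: v)) ->
  exists s t : R, [/\ 0 <= s <= h, 0 <= t <= h &
   F (x + h *: u + h *: v) - F (x + h *: u) - F (x + h *: v) + F x
   = 'D_v ('D_u F) (x + s *: u + t *: v) * h * h].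
Proof.
move=> h0 dF.
have hh : 0 <= h <= h by rewrite ltW/=.
have h0h : 0 <= (0 : R) <= h by rewrite lexx ltW.
pose G p := F (p + h *: v) - F p.
have dq q : differentiable (fun q => q + h *: v) q.
  by apply: (@differentiable_add _ _ _ id (cst (h *: v)));
    [exact: ex_diff|exact: differentiable_cst].
have Dq q w : 'D_w (fun q => q + h *: v) q = w.
  rewrite (@derive_add _ _ _ id (cst (h *: v))); [|exact: ex_diff|exact: differentiable_cst].
  by rewrite derive_cst addr0 derive_id.
have dsh p : differentiable F (p + h *: v) ->
    differentiable (fun q => F (q + h *: v)) p.
  exact: (differentiable_comp (dq p)).
have dG t : 0 <= t <= h ->
    differentiable (fun q => F (q + h *: v)) (x + t *: u) /\
    differentiable F (x + t *: u).
  move=> th; split; first by apply: dsh; have [] := dF t h th hh.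
  by have [] := dF t 0 th h0h; rewrite scale0r addr0.
have [t th|s sh Gs] := @MVT_line G x u h h0.
  by have [d1 d2] := dG t th; exact: differentiableB.
have [|t th DG] := @MVT_line ('D_u F) (x + s *: u) v h h0.
  by move=> t th; have [] := dF s t sh th.
exists s, t; split=> //.
rewrite -DG.
have <- : 'D_u G (x + s *: u) = 'D_u F (x + s *: u + h *: v) - 'D_u F (x + s *: u).
  have [d1 d2] := dG s sh; rewrite /G (derive_sub _ d1 d2); congr (_ - _).
  have [d _] := dF s h sh hh.
  by rewrite (derive_comp _ (dq _) d) Dq.
rewrite -Gs /G; ring.
Qed.

Lemma derive_sym (F : V -> R) U x u v : open U -> U x ->
  (forall y, U y -> differentiable F y /\
    (differentiable ('D_u F) y /\ differentiable ('D_v F) y)) ->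
  {for x, continuous ('D_u ('D_v F))} -> {for x, continuous ('D_v ('D_u F))} ->
  'D_u ('D_v F) x = 'D_v ('D_u F) x.
Proof.
move=> oU Ux dF c1 c2; apply/eqP; apply: contraT => ne.
have e0 : 0 < `|'D_u ('D_v F) x - 'D_v ('D_u F) x| / 2.
  by rewrite divr_gt0// normr_gt0 subr_eq0.
have Un : \near x, U x by exact: open_nbhs_nbhs.
have [d d0 dU] : exists2 d : R, 0 < d & forall y, `|x - y| < d ->
    [/\ U y, `|'D_u ('D_v F) x - 'D_u ('D_v F) y|
              < `|'D_u ('D_v F) x - 'D_v ('D_u F) x| / 2
        & `|'D_v ('D_u F) x - 'D_v ('D_u F) y|
              < `|'D_u ('D_v F) x - 'D_v ('D_u F) x| / 2].
  have /nbhs_ballP[d /= d0 H] : \forall y \near x, [/\ U y,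
      `|'D_u ('D_v F) x - 'D_u ('D_v F) y| < `|'D_u ('D_v F) x - 'D_v ('D_u F) x| / 2
    & `|'D_v ('D_u F) x - 'D_v ('D_u F) y| < `|'D_u ('D_v F) x - 'D_v ('D_u F) x| / 2].
    move: c1 => /cvgrPdist_lt/(_ _ e0) c1; move: c2 => /cvgrPdist_lt/(_ _ e0) c2.
    exact: filterS3 (fun y (a : U y) b c => And3 a b c) Un c1 c2.
  by exists d => // y xy; apply: H; rewrite -ball_normE.
(* The parallelogram with sides h u and h v then stays within distance h (|u| + |v|) < d of [x]; the
   summand 1 covers u = v = 0. *)
set h := d / (2 * (`|u| + `|v| + 1)).
have n0 : 0 < `|u| + `|v| + 1 by rewrite ltr_wpDl// addr_ge0.
have h0 : 0 < h by rewrite divr_gt0// mulr_gt0.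
have near_x s t : 0 <= s <= h -> 0 <= t <= h ->
    `|x - (x + s *: u + t *: v)| < d /\ `|x - (x + t *: v + s *: u)| < d.
  move=> /andP[s0 sh] /andP[t0 th].
  have bd : `|s *: u + t *: v| < d.
    have hd : h * (2 * (`|u| + `|v| + 1)) = d by rewrite divfK// mulf_neq0// gt_eqF.
    apply: le_lt_trans (ler_normD _ _) _; rewrite !normrZ !ger0_norm//.
    have := ler_wpM2r (normr_ge0 u) sh; have := ler_wpM2r (normr_ge0 v) th.
    have := mulr_ge0 (ltW h0) (normr_ge0 u); have := mulr_ge0 (ltW h0) (normr_ge0 v).
    by rewrite -hd; move: (`|u|) (`|v|) h0 => a b; clear; lra.
  by rewrite [in X in _ /\ X]addrAC -addrA opprD addNKr normrN.
have Ud s t : 0 <= s <= h -> 0 <= t <= h ->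
    U (x + s *: u + t *: v) /\ U (x + t *: v + s *: u).
  by move=> sh th; have [/dU[? _ _] /dU[? _ _]] := near_x s t sh th.
have [|s [t [sh th E1]]] := @second_difference F x u v h h0.
  by move=> s t sh th; have [/dF[? []]] := Ud s t sh th.
have [|s' [t' [sh' th' E2]]] := @second_difference F x v u h h0.
  by move=> s' t' sh' th'; have [_ /dF[? []]] := Ud t' s' th' sh'.
have E : 'D_v ('D_u F) (x + s *: u + t *: v) = 'D_u ('D_v F) (x + s' *: v + t' *: u).
  have hn0 : h != 0 by rewrite gt_eqF.
  apply: (mulIf hn0); apply: (mulIf hn0).
  apply: (etrans (esym E1)); apply: (etrans _ E2).
  by rewrite (addrAC x (h *: u)); congr (_ + _); exact: addrAC.
have [/dU[_ _ A1] _] := near_x s t sh th.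
have [_ /dU[_ A2 _]] := near_x t' s' th' sh'.
rewrite E in A1; move: A1 A2; move: ('D_u _ x) ('D_v _ x) ('D_u _ _) => a b e.
(* [e] is the common value of the two mixed derivatives at nearby points, and it lies within |a - b|
   / 2 of both [a] and [b]. *)
clear=> A1 A2; have : `|a - b| < `|a - b|; last by rewrite ltxx.
rewrite [ltRHS]splitr -{1}(subrKA e a) -[e - b]opprB.
by apply: le_lt_trans (ler_normB _ _) _; exact: ltrD.
Qed.

End Schwarz.

Section Smooth.
Variables (R : realType) (m : nat).
Implicit Types (U : set 'rV[R]_m) (x u v : 'rV[R]_m).

Lemma smooth_on_differentiable (W : normedModType R) U (F : 'rV[R]_m -> W) x :
  smooth_on U F -> U x -> differentiable F x.
Proof. by move=> sF; exact: (sF [::]). Qed.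

Lemma smooth_on_derive (W : normedModType R) U (F : 'rV[R]_m -> W) v :
  smooth_on U F -> smooth_on U ('D_v F).
Proof. by move=> sF s x Ux; have := sF (rcons s v) x Ux; rewrite foldr_rcons. Qed.

Lemma smooth_on_cst (W : normedModType R) U (w : W) :
  smooth_on U (cst w : 'rV[R]_m -> W).
Proof.
move=> s x _; suff [w' ->] : exists w', foldr (fun v h => 'D_v h) (cst w) s = cst w'.
  exact: differentiable_cst.
elim: s => [|v s [w' IH]]; first by exists w.
by exists 0; rewrite /= IH; apply/funext => y; rewrite derive_cst.
Qed.

(** Argued entry by entry, since [derive_sym] rests on the mean value theorem for real-valued
    functions. *)
Lemma smooth_derive_sym p q U (F : 'rV[R]_m -> 'M[R]_(p, q)) x u v :
  open U -> smooth_on U F -> U x -> 'D_u ('D_v F) x = 'D_v ('D_u F) x.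
Proof.
move=> oU sF Ux; apply/matrixP => i j.
have d w y : U y -> differentiable ('D_w F) y.
  by move=> Uy; exact: (smooth_on_differentiable (smooth_on_derive w sF)).
have d2 w w' y : U y -> differentiable ('D_w ('D_w' F)) y.
  move=> Uy; apply: (smooth_on_differentiable _ Uy).
  by do 2!apply: smooth_on_derive.
have D1 w y : U y -> 'D_w (fun z => F z i j) y = 'D_w F y i j.
  by move=> Uy; rewrite derive_entry//; exact: smooth_on_differentiable Uy.
have dD1 w y : U y -> differentiable ('D_w (fun z => F z i j)) y.
  move=> Uy; apply: (differentiable_on_eq oU Uy (D1 w)).
  exact/differentiable_entry/d.
have D2 w w' y : U y -> 'D_w ('D_w' (fun z => F z i j)) y = 'D_w ('D_w' F) y i j.
  by move=> Uy; rewrite (derive_near _ oU Uy (D1 w')) derive_entry//; exact: d.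
have dD2 w w' y : U y -> differentiable ('D_w ('D_w' (fun z => F z i j))) y.
  move=> Uy; apply: (differentiable_on_eq oU Uy (D2 w w')).
  exact/differentiable_entry/d2.
apply: (etrans (esym (D2 u v x Ux))); apply: (etrans _ (D2 v u x Ux)).
apply: (derive_sym oU Ux).
- move=> y Uy; split; last by split; exact: dD1.
  by apply: differentiable_entry; exact: smooth_on_differentiable Uy.
- exact: (differentiable_continuous (dD2 u v x Ux)).
- exact: (differentiable_continuous (dD2 v u x Ux)).
Qed.

End Smooth.

Lemma mx_addE (R : realType) p q (A B : 'M[R]_(p, q)) i j :
  (A + B) i j = A i j + B i j.
Proof. exact: mxE. Qed.
Lemma mx_oppE (R : realType) p q (A : 'M[R]_(p, q)) i j : (- A) i j = - A i j.
Proof. exact: mxE. Qed.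
Lemma mx_scaleE (R : realType) p q a (A : 'M[R]_(p, q)) i j :
  (a *: A) i j = a * A i j.
Proof. exact: mxE. Qed.
Lemma mx_0E (R : realType) p q i j : (0 : 'M[R]_(p, q)) i j = 0.
Proof. exact: mxE. Qed.

Lemma trmxD (R : realType) p q (A B : 'M[R]_(p, q)) : (A + B)^T = A^T + B^T.
Proof. exact: linearD. Qed.
Lemma trmxN (R : realType) p q (A : 'M[R]_(p, q)) : (- A)^T = - A^T.
Proof. exact: linearN. Qed.
Lemma trmxZ (R : realType) p q a (A : 'M[R]_(p, q)) : (a *: A)^T = a *: A^T.
Proof. exact: linearZ. Qed.

Ltac mx_entries := rewrite ?(mx_addE, mx_oppE, mx_scaleE, mx_0E).

(* Products of matrices are expanded into monomials, which [ring] then treats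
   entrywise as atoms. *)
Ltac mx_expand :=
  rewrite ?(trmx_mul, trmxD, trmxN, trmxZ, trmxK)
    ?(mulmxDl, mulmxDr, mulmxBl, mulmxBr, mulNmx, mulmxN, mulmxA,
      mulmx0, mul0mx) -?scalemxAl -?scalemxAr ?mulmxA.

Ltac mx_close := apply/matrixP => ? ?; mx_entries; ring.

Ltac mx_lin := mx_expand; mx_close.

(** * Matrices as bilinear forms, and the algebra behind the curvature identities *)

Section Inner.
Variables (R : realType) (m : nat) (G : 'M[R]_m).
Implicit Types u v w : 'rV[R]_m.

Lemma inner_Dl u v w : inner G (u + v) w = inner G u w + inner G v w.
Proof. by rewrite /inner !mulmxDl mxE. Qed.
Lemma inner_Dr u v w : inner G w (u + v) = inner G w u + inner G w v.
Proof. by rewrite /inner linearD mulmxDr mxE. Qed.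
Lemma inner_Nl u w : inner G (- u) w = - inner G u w.
Proof. by rewrite /inner !mulNmx mxE. Qed.
Lemma inner_Nr u w : inner G w (- u) = - inner G w u.
Proof. by rewrite /inner linearN mulmxN mxE. Qed.
Lemma inner_Bl u v w : inner G (u - v) w = inner G u w - inner G v w.
Proof. by rewrite inner_Dl inner_Nl. Qed.
Lemma inner_Br u v w : inner G w (u - v) = inner G w u - inner G w v.
Proof. by rewrite inner_Dr inner_Nr. Qed.
Lemma inner_Zl a u w : inner G (a *: u) w = a * inner G u w.
Proof. by rewrite /inner -!scalemxAl mxE. Qed.
Lemma inner_Zr a u w : inner G w (a *: u) = a * inner G w u.
Proof. by rewrite /inner linearZ -scalemxAr mxE. Qed.
Lemma inner_0l w : inner G 0 w = 0.
Proof. by rewrite /inner !mul0mx mxE. Qed.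
Lemma inner_0r w : inner G w 0 = 0.
Proof. by rewrite /inner trmx0 mulmx0 mxE. Qed.

Lemma inner_suml I (r : seq I) (P : pred I) (F : I -> 'rV[R]_m) w :
  inner G (\sum_(i <- r | P i) F i) w = \sum_(i <- r | P i) inner G (F i) w.
Proof. by rewrite /inner !mulmx_suml summxE. Qed.
Lemma inner_sumr I (r : seq I) (P : pred I) (F : I -> 'rV[R]_m) w :
  inner G w (\sum_(i <- r | P i) F i) = \sum_(i <- r | P i) inner G w (F i).
Proof. by rewrite /inner linear_sum mulmx_sumr summxE. Qed.

Lemma inner_basis i j : inner G (basis_vec R i) (basis_vec R j) = G i j.
Proof.
by rewrite /inner /basis_vec -rowE trmx_delta -colE !mxE.
Qed.

Lemma row_basis u : u = \sum_i u 0 i *: basis_vec R i.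
Proof. exact: row_sum_delta. Qed.

Lemma inner_row u k : inner G u (basis_vec R k) = (u *m G) 0 k.
Proof. by rewrite /inner /basis_vec trmx_delta -colE mxE. Qed.

Lemma inner_symP : (forall u v, inner G u v = inner G v u) <-> G^T = G.
Proof.
split=> [H|H u v].
  by apply/matrixP => i j; rewrite mxE -!inner_basis.
have -> : inner G v u = (v *m G *m u^T)^T 0 0 by rewrite mxE.
by rewrite !trmx_mul trmxK H mulmxA.
Qed.

Lemma inner_inj u v : G \in unitmx -> (forall w, inner G u w = inner G v w) -> u = v.
Proof.
move=> uG H; rewrite -[u](mulmxK uG) -[v](mulmxK uG); congr (_ *m _).
by apply/rowP => k; rewrite -!inner_row.
Qed.

(** A nonzero row of the kernel would be an isotropic vector. *)
Lemma posdef_unitmx : (forall u, u != 0 -> 0 < inner G u u) -> G \in unitmx.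
Proof.
move=> pos; rewrite -row_free_unit -kermx_eq0; apply/eqP/row_matrixP => i.
rewrite row0; apply/eqP; apply: contraT => /pos.
by rewrite /inner -row_mul mulmx_ker row0 mul0mx mxE ltxx.
Qed.

Lemma inner_raise (l : 'rV[R]_m) w : G \in unitmx -> inner G (raise G l) w = (l *m w^T) 0 0.
Proof. by move=> uG; rewrite /inner /raise mulmxKV. Qed.

End Inner.

Lemma inner_mul (R : realType) m (G A : 'M[R]_m) u v :
  inner G (u *m A) v = inner (A *m G) u v.
Proof. by rewrite /inner mulmxA. Qed.

Lemma inner_mulr (R : realType) m (G A : 'M[R]_m) u v :
  inner G u (v *m A) = inner (G *m A^T) u v.
Proof. by rewrite /inner trmx_mul !mulmxA. Qed.

Lemma inner_addG (R : realType) m (G A : 'M[R]_m) u v :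
  inner (G + A) u v = inner G u v + inner A u v.
Proof. by rewrite /inner mulmxDr mulmxDl mxE. Qed.

Lemma inner_matrixP (R : realType) m (G A : 'M[R]_m) :
  (forall u v, inner G u v = inner A u v) -> G = A.
Proof. by move=> H; apply/matrixP => i j; rewrite -!inner_basis. Qed.

Lemma eq_row_action (R : realType) p m (A B : 'M[R]_(p, m)) :
  (forall u : 'rV_p, u *m A = u *m B) -> A = B.
Proof. by move=> H; apply/row_matrixP => i; rewrite !rowE. Qed.


Lemma inner_sumG (R : realType) m I (r : seq I) (P : pred I) a (C : I -> 'M[R]_m) u v :
  inner (\sum_(i <- r | P i) a i *: C i) u v = \sum_(i <- r | P i) a i * inner (C i) u v.
Proof.
rewrite /inner mulmx_sumr mulmx_suml summxE; apply: eq_bigr => i _.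
by rewrite -scalemxAr -scalemxAl mxE.
Qed.

(** [christoffel] is defined through its products with basis vectors only; this passes to an
    arbitrary test vector [w]. The [C i] stand for the derivatives of the metric along the basis,
    whose combination with the coefficients of [w] is the derivative along [w]. [koszul_suml] plays
    the same role for the argument [v]. *)
Lemma koszul_sumr (R : realType) m (A B : 'M[R]_m) (C : 'I_m -> 'M[R]_m) u v w :
  2^-1 * (inner A v w + inner B u w - inner (\sum_i w 0 i *: C i) u v)
  = \sum_i w 0 i * (2^-1 * (inner A v (basis_vec R i) + inner B u (basis_vec R i)
                           - inner (C i) u v)).
Proof.
rewrite inner_sumG {1 2}[w]row_basis !inner_sumr -big_split /= -sumrB mulr_sumr.
by apply: eq_bigr => k _; rewrite !inner_Zr; ring.
Qed.

Lemma koszul_suml (R : realType) m (A B : 'M[R]_m) (C : 'I_m -> 'M[R]_m) u v w :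
  2^-1 * (inner A v w + inner (\sum_i v 0 i *: C i) u w - inner B u v)
  = \sum_i v 0 i * (2^-1 * (inner A (basis_vec R i) w + inner (C i) u w
                           - inner B u (basis_vec R i))).
Proof.
rewrite inner_sumG {1 3}[v]row_basis inner_sumr inner_suml -big_split /= -sumrB mulr_sumr.
by apply: eq_bigr => k _; rewrite inner_Zr inner_Zl; ring.
Qed.

(** Read [a], [b], [c] as the connection matrices along [u], [v], [w], and [Duv] as the derivative
    along [u] of the matrix along [v]. The hypotheses are then vanishing torsion and its
    derivatives, and the first Bianchi identity is noncommutative algebra. *)
Lemma bianchi_algebra (R : realType) m (u v w : 'rV[R]_m)
    (a b c Duv Dvu Dvw Dwv Dwu Duw : 'M[R]_m) :
  v *m a = u *m b -> w *m b = v *m c -> u *m c = w *m a ->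
  u *m Dwv = v *m Dwu -> v *m Duw = w *m Duv -> w *m Dvu = u *m Dvw ->
  w *m (Duv + b *m a - Dvu - a *m b) + u *m (Dvw + c *m b - Dwv - b *m c)
    + v *m (Dwu + a *m c - Duw - c *m a) = 0.
Proof.
move=> h1 h2 h3 e1 e2 e3.
rewrite !mulmxDr !mulmxN !mulmxA e1 e2 e3.
rewrite h1 h2 -h3; mx_lin.
Qed.

(** The octahedron argument: four Bianchi identities are combined by means of skewness in each pair.
    Only values of [K] enter, so it serves the Riemann tensor and the abstract tensor of the
    polarization alike. *)
Lemma curvature_pair_sym (R : realType) (T : Type) (K : T -> T -> T -> T -> R) :
  (forall a b c d, K b a c d = - K a b c d) ->
  (forall a b c d, K a b d c = - K a b c d) ->
  (forall a b c d, K a b c d + K b c a d + K c a b d = 0) ->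
  forall a b c d, K a b c d = K c d a b.
Proof.
move=> K1 K2 KB a b c d.
have := KB a b c d; have := KB b c d a; have := KB c d a b; have := KB d a b c.
have := K2 b c a d; have := K2 c d a b; have := K2 a b c d; have := K2 d a b c.
have := K1 a c b d; have := K2 a c b d; have := K1 b d c a; have := K2 b d a c.
lra.
Qed.

Lemma metric_unit (R : realType) m (N : manifold R m) (h : metric N) (a : atlas N) x :
  img a x -> h a x \in unitmx.
Proof. by move=> ax; apply: posdef_unitmx => u; exact: metric_pos. Qed.

(** * Levi-Civita connection and curvature as matrices *)

Section LeviCivita.
Variables (R : realType) (m : nat) (N : manifold R m) (h : metric N) (a : atlas N).
Implicit Types (x u v w z : 'rV[R]_m).

Local Notation U := (img a).
Local Notation G := (h a).

Let oU : open U.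
Proof. exact: img_open. Qed.
Let sG : smooth_on U G.
Proof. exact: metric_smooth. Qed.
Let symG x u v : U x -> inner (G x) u v = inner (G x) v u.
Proof. exact: Defs.metric_sym. Qed.
Let unitG x : U x -> G x \in unitmx.
Proof. exact: metric_unit. Qed.
Let dG x : U x -> differentiable G x.
Proof. exact: smooth_on_differentiable sG. Qed.
Let dDG u x : U x -> differentiable ('D_u G) x.
Proof. exact: (smooth_on_differentiable (smooth_on_derive u sG)). Qed.

Definition conn u x : 'M[R]_m := \matrix_i christoffel G x u (basis_vec R i).

Definition koszul x u v w : R :=
  2^-1 * (inner ('D_u G x) v w + inner ('D_v G x) u w - inner ('D_w G x) u v).

Lemma derive_dir_basis x u : U x -> 'D_u G x = \sum_i u 0 i *: 'D_(basis_vec R i) G x.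
Proof. by move=> Ux; rewrite {1}[u]row_basis derive_dir_sum//; exact: dG. Qed.

Lemma inner_christoffel x u v w : U x ->
  inner (G x) (christoffel G x u v) w = koszul x u v w.
Proof.
move=> Ux; rewrite inner_raise; last exact: unitG.
rewrite {1}[w]row_basis linear_sum mulmx_sumr summxE.
have -> : koszul x u v w = \sum_k w 0 k * koszul x u v (basis_vec R k).
  by rewrite /koszul (derive_dir_basis w Ux) koszul_sumr.
apply: eq_bigr => k _.
by rewrite [X in _ *m X]linearZ -scalemxAr mxE [X in _ *m X]/= /basis_vec trmx_delta -colE !mxE.
Qed.

Lemma christoffel_conn x u v : U x -> christoffel G x u v = v *m conn u x.
Proof.
move=> Ux; apply: (inner_inj (unitG Ux)) => w.
rewrite inner_christoffel// {2}[v]row_basis mulmx_suml inner_suml.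
have -> : koszul x u v w = \sum_k v 0 k * koszul x u (basis_vec R k) w.
  by rewrite /koszul (derive_dir_basis v Ux) koszul_suml.
apply: eq_bigr => k _; rewrite -scalemxAl inner_Zl -rowE rowK.
by rewrite inner_christoffel.
Qed.

Lemma inner_derive_sym x u v w : U x -> inner ('D_u G x) v w = inner ('D_u G x) w v.
Proof.
move=> Ux; suff /inner_symP-> : ('D_u G x)^T = 'D_u G x by [].
rewrite -derive_trmx; last exact: dG.
by apply: derive_near oU Ux _ => y Uy; apply/inner_symP => ? ?; exact: symG.
Qed.

Lemma conn_torsion x u v : U x -> v *m conn u x = u *m conn v x.
Proof.
move=> Ux; rewrite -!christoffel_conn//; apply: (inner_inj (unitG Ux)) => w.
rewrite (inner_christoffel u v w Ux) (inner_christoffel v u w Ux).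
have E (p q c d : R) : c = d -> 2^-1 * (p + q - c) = 2^-1 * (q + p - d).
  by move=> ->; rewrite (addrC p).
exact: E (inner_derive_sym w u v Ux).
Qed.

Lemma conn_metric x u : U x -> conn u x *m G x + G x *m (conn u x)^T = 'D_u G x.
Proof.
move=> Ux; apply: inner_matrixP => v w.
rewrite inner_addG -inner_mul -inner_mulr -!christoffel_conn//.
rewrite (symG v (christoffel G x u w) Ux).
rewrite (inner_christoffel u v w Ux) (inner_christoffel u w v Ux).
have E (p p' b c : R) : p' = p -> 2^-1 * (p + b - c) + 2^-1 * (p' + c - b) = p.
  by move=> ->; field.
exact: E (inner_derive_sym u w v Ux).
Qed.

Lemma differentiable_conn x u : U x -> differentiable (conn u) x.
Proof.
move=> Ux; apply: differentiable_mx => i j.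
under eq_fun do rewrite mxE.
apply: differentiable_entry; apply: differentiable_mulmx; last first.
  exact: (differentiable_invmx oU Ux unitG (dG Ux)).
apply: differentiable_mx => ? k.
under eq_fun do rewrite mxE.
have dI v p q : differentiable (fun y => inner ('D_v G y) p q) x.
  apply: differentiable_entry; apply: differentiable_mulmx; last exact: differentiable_cst.
  by apply: differentiable_mulmx; [exact: differentiable_cst|exact: dDG].
apply: differentiableM; first exact: differentiable_cst.
by apply: differentiable_sub; first exact: differentiable_add.
Qed.

(** Vectors are rows, so [conn v x *m conn u x] applies the matrix along [v] first: this is nabla_u
    nabla_v - nabla_v nabla_u on constant fields. *)
Definition riem u v x : 'M[R]_m :=
  'D_u (conn v) x + conn v x *m conn u x - 'D_v (conn u) x - conn u x *m conn v x.

Lemma cov_conn x u V : U x -> cov G u V x = 'D_u V x + V x *m conn u x.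
Proof. by move=> Ux; rewrite /cov christoffel_conn. Qed.

Lemma cov_cst x u v : U x -> cov G u (cst v) x = v *m conn u x.
Proof. by move=> Ux; rewrite cov_conn// derive_cst add0r. Qed.

Lemma curv_riem x u v w : U x -> curv G x u v w = w *m riem u v x.
Proof.
move=> Ux.
have E u1 v1 : cov G u1 (cov G v1 (cst w)) x
    = w *m 'D_u1 (conn v1) x + w *m conn v1 x *m conn u1 x.
  rewrite cov_conn// cov_cst//; congr (_ + _).
  rewrite (derive_near u1 oU Ux (G := fun y => w *m conn v1 y)); last first.
    by move=> y Uy; rewrite cov_cst.
  rewrite derive_mulmx; [|exact: differentiable_cst|exact: differentiable_conn].
  by rewrite derive_cst mul0mx add0r.
rewrite /curv !E /riem; move: ('D_u _ _) ('D_v _ _) => p q; mx_lin.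
Qed.

Lemma riem_anti x u v : riem v u x = - riem u v x.
Proof. rewrite /riem; move: ('D_u _ _) ('D_v _ _) => p q; mx_lin. Qed.

Lemma derive_conn_torsion x u v w : U x ->
  v *m 'D_w (conn u) x = u *m 'D_w (conn v) x.
Proof.
move=> Ux; have E p q : 'D_w (fun y => p *m conn q y) x = p *m 'D_w (conn q) x.
  rewrite derive_mulmx; [|exact: differentiable_cst|exact: differentiable_conn].
  by rewrite derive_cst mul0mx add0r.
by rewrite -!E; apply: (derive_near w oU Ux) => y Uy; exact: conn_torsion.
Qed.

Lemma riem_bianchi x u v w : U x ->
  w *m riem u v x + u *m riem v w x + v *m riem w u x = 0.
Proof.
move=> Ux.
exact: (bianchi_algebra (conn_torsion u v Ux) (conn_torsion v w Ux) (conn_torsion w u Ux)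
 (derive_conn_torsion v u w Ux) (derive_conn_torsion w v u Ux) (derive_conn_torsion u w v Ux)).
Qed.

(** The left-hand side is, up to sign, the difference of ['D_u ('D_v G)] and ['D_v ('D_u G)] once
    both are expanded by metric compatibility. *)
Lemma riem_metric x u v : U x -> riem u v x *m G x + G x *m (riem u v x)^T = 0.
Proof.
move=> Ux.
have E p q : 'D_p ('D_q G) x = 'D_p (conn q) x *m G x + conn q x *m 'D_p G x
    + ('D_p G x *m (conn q x)^T + G x *m ('D_p (conn q) x)^T).
  have dg := differentiable_conn q Ux.
  have dgT := differentiable_trmx dg.
  rewrite (derive_near p oU Ux
    (G := fun y => conn q y *m G y + G y *m (conn q y)^T)); last first.
    by move=> y Uy; rewrite conn_metric.
  rewrite derive_add; [|apply: differentiable_mulmx => //; exact: dG..].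
  rewrite !derive_mulmx ?derive_trmx//; exact: dG.
have := smooth_derive_sym u v oU sG Ux.
rewrite (E u v) (E v u) -(conn_metric u Ux) -(conn_metric v Ux) /riem => /eqP.
rewrite -subr_eq0 => /eqP <-.
by move: ('D_u _ _) ('D_v _ _) => p q; mx_lin.
Qed.

Lemma inner_riem_anti x u v w z : U x ->
  inner (G x) (w *m riem u v x) z = - inner (G x) (z *m riem u v x) w.
Proof.
move=> Ux; rewrite (symG (z *m _) w Ux) inner_mul inner_mulr.
apply/eqP; rewrite -addr_eq0 -inner_addG riem_metric//.
by rewrite /inner mulmx0 mul0mx mxE.
Qed.

Lemma inner_riem_pair x u v w z : U x ->
  inner (G x) (w *m riem u v x) z = inner (G x) (u *m riem w z x) v.
Proof.
move=> Ux; pose K p q c d := inner (G x) (c *m riem p q x) d.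
apply: (@curvature_pair_sym _ _ K) => p q c d; rewrite /K.
- by rewrite riem_anti mulmxN inner_Nl.
- exact: inner_riem_anti.
- by rewrite -!inner_Dl riem_bianchi// inner_0l.
Qed.

End LeviCivita.

(** * Curvature of Sasakian space forms *)

Section KaehlerPolarization.
Variables (R : realType) (V : zmodType) (D : V -> Prop) (J : V -> V).
Variable T : V -> V -> V -> V -> R.
Hypotheses (DD : forall a b, D a -> D b -> D (a + b)) (DN : forall a, D a -> D (- a)).
Hypotheses (DJ : forall a, D (J a)) (JD : forall a b, J (a + b) = J a + J b).
Hypothesis JJ : forall a, D a -> J (J a) = - a.
Hypothesis T_add : forall a b c c' d, T a b (c + c') d = T a b c d + T a b c' d.
Hypothesis T_antil : forall a b c d, T b a c d = - T a b c d.
Hypothesis T_antir : forall a b c d, T a b d c = - T a b c d.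
Hypothesis T_bianchi : forall a b c d, T a b c d + T b c a d + T c a b d = 0.
Hypothesis T_J : forall a b c d, D c -> D d -> T a b (J c) (J d) = T a b c d.
Hypothesis T_hol : forall a, D a -> T a (J a) (J a) a = 0.

Let T_pair a b c d : T a b c d = T c d a b.
Proof. exact: curvature_pair_sym. Qed.

Let T_opp a b c d : T a b (- c) d = - T a b c d.
Proof.
have T0 : T a b 0 d = 0.
  by apply: (addrI (T a b 0 d)); rewrite -T_add !addr0.
by apply: (addrI (T a b c d)); rewrite -T_add !subrr.
Qed.

Let T_add4 a b c d d' : T a b c (d + d') = T a b c d + T a b c d'.
Proof. by rewrite T_antir T_add opprD -!(T_antir a b). Qed.
Let T_add1 a a' b c d : T (a + a') b c d = T a b c d + T a' b c d.
Proof. by rewrite !(T_pair _ b) T_add. Qed.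
Let T_add2 a b b' c d : T a (b + b') c d = T a b c d + T a b' c d.
Proof. by rewrite !(T_pair a) T_add4. Qed.
Let T_opp4 a b c d : T a b c (- d) = - T a b c d.
Proof. by rewrite T_antir T_opp -T_antir. Qed.
Let T_opp1 a b c d : T (- a) b c d = - T a b c d.
Proof. by rewrite !(T_pair _ b) T_opp. Qed.
Let T_opp2 a b c d : T a (- b) c d = - T a b c d.
Proof. by rewrite !(T_pair a) T_opp4. Qed.

Let T_swapr a b c d : D c -> D d -> T a b (J c) d = T a b (J d) c.
Proof.
move=> Dc Dd; rewrite -[d in LHS]opprK -(JJ Dd) T_opp4 T_J; last 2 first.
- by [].
- exact: DJ.
by rewrite -T_antir.
Qed.

Let T_swapl a b c d : D a -> D b -> T a (J b) c d = T b (J a) c d.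
Proof.
by move=> Da Db; rewrite T_antil [RHS]T_antil !(T_pair (J _)) T_swapr.
Qed.

Let J_opp a : J (- a) = - J a.
Proof.
have J0 : J 0 = 0 by apply: (addrI (J 0)); rewrite -JD !addr0.
by apply: (addrI (J a)); rewrite -JD !subrr.
Qed.

(* [T_hol] at [x + y] and at [x - y] *)
Let T_mixed x y : D x -> D y -> T x (J x) (J y) y + 2 * T x (J y) (J y) x = 0.
Proof.
move=> Dx Dy.
have := T_hol (DD Dx Dy); have := T_hol (DD Dx (DN Dy)).
rewrite !JD J_opp !(T_add1, T_add2, T_add, T_add4, T_opp1, T_opp2, T_opp, T_opp4).
rewrite (T_hol Dx) (T_hol Dy).
have e1 : T y (J y) (J x) x = T x (J x) (J y) y.
  by rewrite T_pair T_antil T_antir opprK.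
have e2 : T x (J y) (J x) y = T x (J y) (J y) x by rewrite T_swapr.
have e3 : T y (J x) (J x) y = T x (J y) (J y) x by rewrite T_swapr// T_swapl.
have e4 : T y (J x) (J y) x = T x (J y) (J y) x by rewrite T_swapl.
rewrite e1 e2 e3 e4; lra.
Qed.

(** The Bianchi identity on x, Jx, Jy, y gives T(x, Jx, Jy, y) = T(x, y, y, x) + T(x, Jy, Jy, x),
    and [T_mixed] eliminates the left side. *)
Let T_rotate x y : D x -> D y -> T x y y x = - 3 * T x (J y) (J y) x.
Proof.
move=> Dx Dy; have := T_mixed Dx Dy; have := T_bianchi x (J x) (J y) y.
have -> : T (J x) (J y) x y = - T x y y x.
  by rewrite T_pair T_J// -T_antir.
have -> : T (J y) x (J x) y = - T x (J y) (J y) x by rewrite T_antil T_swapr.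
lra.
Qed.

(** Applying [T_rotate] to y and then to Jy multiplies T(x, y, y, x) by 9, so it vanishes. *)
Let T_sectional x y : D x -> D y -> T x y y x = 0.
Proof.
move=> Dx Dy; have := T_rotate Dx Dy; have := T_rotate Dx (DJ y).
rewrite JJ// T_opp2 T_opp; lra.
Qed.

Let T_repeat a b c : D a -> D b -> D c -> T a b c a = 0.
Proof.
move=> Da Db Dc; have := T_sectional Da (DD Db Dc).
rewrite T_add2 !T_add !T_sectional//.
rewrite (T_pair a c) (T_antil a b) T_antir; lra.
Qed.

(** Sectional curvatures vanish, hence T(a, b, c, a) = 0 by polarizing in the middle slots;
    polarizing once more at a = x + z gives the claim. This symmetrized form is what a trace over a
    symmetric matrix requires. *)
Lemma kaehler_polarization x h z w : D x -> D h -> D z -> D w ->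
  T x h z w + T z h x w = 0.
Proof.
move=> Dx Dh Dz Dw; have := T_repeat (DD Dx Dz) Dh Dw.
rewrite T_add1 !T_add4 !T_repeat// (T_antir _ _ z) (T_antir _ _ x); lra.
Qed.

End KaehlerPolarization.

(* The hypothesis on [p] and [q] is the symmetry of the second derivatives of
   phi, the covariant derivatives of g, phi and xi having been substituted. *)
Lemma phi_curvature_algebra (R : realType) m (G F gu gv p q : 'M[R]_m) (X u v : 'rV[R]_m) :
  let dG g := g *m G + G *m g^T in
  let dF g w := g *m F - F *m g + G *m w^T *m X - G *m X^T *m w in
  let dX g w := - (w *m F) - X *m g in
  let ddF g w g' w' r := r *m F + g' *m dF g w - (dF g w *m g' + F *m r)
    + (dG g *m w'^T *m X + G *m w'^T *m dX g w)
    - (dG g *m X^T + G *m (dX g w)^T) *m w' in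
  v *m gu = u *m gv -> ddF gv v gu u p = ddF gu u gv v q ->
  F *m (q + gv *m gu - p - gu *m gv) - (q + gv *m gu - p - gu *m gv) *m F
  = G *m (u *m F)^T *m v - G *m v^T *m (u *m F)
    + G *m u^T *m (v *m F) - G *m (v *m F)^T *m u.
Proof.
move=> dG dF dX ddF T /eqP; rewrite -subr_eq0 => /eqP H.
apply/eqP; rewrite -subr_eq0; apply/eqP; rewrite -[RHS]H /ddF /dF /dX /dG.
have T1 : G *m X^T *m v *m gu = G *m X^T *m u *m gv by rewrite -!mulmxA T.
have T2 : G *m gu^T *m v^T *m X = G *m gv^T *m u^T *m X.
  by rewrite -(mulmxA G) -trmx_mul T trmx_mul mulmxA.
mx_expand; rewrite T1 T2; mx_close.
Qed.

Section SasakianChart.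
Variables (R : realType) (n : nat) (N : manifold R n.*2.+1) (h : metric N).
Variables (S : contact_metric h) (a : atlas N).
Implicit Types u v w x z : 'rV[R]_(n.*2.+1).

Local Notation F := (phi S a).
Local Notation X := (xi S a).
Local Notation G := (h a).

Lemma xi_neq0 x : img a x -> X x != 0.
Proof.
move=> ax; apply/eqP => X0; have := eta_xi S ax.
by rewrite /pairing X0 mul0mx mxE => /eqP; rewrite eq_sym oner_eq0.
Qed.

(** phi^2 xi = 0 by [phi_sqr]. Applying [phi_sqr] to phi xi gives phi xi = l xi with l = eta(phi
    xi), so l^2 xi = 0 and l = 0. *)
Lemma xi_phi x : img a x -> X x *m F x = 0.
Proof.
move=> ax.
have X2 : X x *m F x *m F x = 0.
  by rewrite (phi_sqr S _ ax) (eta_xi S ax) scale1r addNr.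
have := phi_sqr S (X x *m F x) ax; rewrite X2 mul0mx.
set l := pairing _ _ => /eqP; rewrite eq_sym addrC subr_eq0 => /eqP lX.
move: X2; rewrite -lX -scalemxAl -lX scalerA => /eqP.
by rewrite scaler_eq0 (negPf (xi_neq0 ax)) orbF mulf_eq0 orbb => /eqP->; rewrite scale0r.
Qed.

Lemma inner_xi x u : img a x -> inner (G x) u (X x) = pairing (eta S a x) u.
Proof.
move=> ax; have := metric_phi S u (X x) ax.
by rewrite xi_phi// inner_0r eta_xi// mulr1 => /eqP; rewrite eq_sym subr_eq0 => /eqP.
Qed.

Lemma inner_xixi x : img a x -> inner (G x) (X x) (X x) = 1.
Proof. by move=> ax; rewrite inner_xi// eta_xi. Qed.

Lemma eta_lower x : img a x -> eta S a x = G x *m (X x)^T.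
Proof.
move=> ax; apply: eq_row_action => u; apply/matrixP => i j; rewrite !ord1.
by rewrite -[LHS]/(pairing _ u) -inner_xi// /inner mulmxA.
Qed.

(** phi is skew because d eta is. *)
Lemma inner_phir x u v : img a x ->
  inner (G x) u (v *m F x) = - inner (G x) (u *m F x) v.
Proof.
move=> ax; rewrite [in RHS](Defs.metric_sym h _ _ ax) !(contact_eta S _ _ ax) /ext_deriv.
by rewrite -mulrN opprB.
Qed.

Lemma inner_phi_self x u : img a x -> inner (G x) u (u *m F x) = 0.
Proof.
by move=> ax; have := inner_phir u u ax; rewrite (Defs.metric_sym h (u *m F x) u ax); lra.
Qed.

Lemma inner_phi_xi x u : img a x -> inner (G x) (u *m F x) (X x) = 0.
Proof.
move=> ax; rewrite (Defs.metric_sym h _ _ ax) inner_phir// xi_phi// inner_0l; lra.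
Qed.

Lemma phi_phi x u : img a x -> inner (G x) u (X x) = 0 -> u *m F x *m F x = - u.
Proof. by move=> ax uX; rewrite phi_sqr// -inner_xi// uX scale0r addr0. Qed.

Lemma inner_phi2 x u v : img a x -> inner (G x) u (X x) = 0 ->
  inner (G x) (u *m F x) (v *m F x) = inner (G x) u v.
Proof. by move=> ax uX; rewrite metric_phi// -inner_xi// uX mul0r subr0. Qed.

Hypothesis sas : sasakian S.

Local Notation conn := (conn h a).
Local Notation riem := (riem h a).

Let oU : open (img a).
Proof. exact: img_open. Qed.
Let sG : smooth_on (img a) G.
Proof. exact: metric_smooth. Qed.
Let symG x u v (ax : img a x) : inner (G x) u v = inner (G x) v u :=
  Defs.metric_sym h u v ax.
Let dG x : img a x -> differentiable G x.
Proof. exact: smooth_on_differentiable sG. Qed.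
Let dF x : img a x -> differentiable F x.
Proof. exact: smooth_on_differentiable (@endo_smooth _ _ _ (phi S) a). Qed.
Let dX x : img a x -> differentiable X x.
Proof. exact: smooth_on_differentiable (@vector_smooth _ _ _ (xi S) a). Qed.
Let dgam u x (ax : img a x) : differentiable (conn u) x :=
  differentiable_conn h u ax.

(** The Sasakian condition tested on constant fields. The rank-one matrices encode v |-> g(u, v) xi
    and v |-> eta(v) u. *)
Lemma derive_phi x u : img a x -> 'D_u F x =
  conn u x *m F x - F x *m conn u x + G x *m u^T *m X x - eta S a x *m u.
Proof.
move=> ax; apply: eq_row_action => v.
have := @sas a (cst v) (smooth_on_cst v) x u ax.
rewrite !(cov_conn h)// derive_cst add0r.
rewrite derive_mulmx; [|exact: differentiable_cst|exact: dF].
rewrite derive_cst mul0mx add0r.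
have -> : inner (G x) u (v : 'rV_(n.*2.+1)) *: X x = v *m (G x *m u^T *m X x).
  rewrite symG// /inner !mulmxA; apply/matrixP => i j.
  by rewrite ord1 [in RHS]mxE big_ord1 mx_scaleE.
have -> : pairing (eta S a x) v *: u = v *m (eta S a x *m u).
  rewrite mulmxA; apply/matrixP => i j.
  by rewrite ord1 [in RHS]mxE big_ord1 mx_scaleE.
rewrite /cst; move: ('D_u _ _) (conn _ _) => p q /eqP.
rewrite subr_eq => /eqP E; rewrite -[v *m p](addrK (v *m F x *m q)) E; mx_lin.
Qed.

(** The Sasakian condition for the field xi itself, where phi xi = 0, determines phi(nabla_u xi).
    Since xi has unit length, nabla_u xi is orthogonal to xi, and a second application of phi
    recovers it. *)
Lemma cov_xi x u : img a x -> 'D_u X x + X x *m conn u x = - (u *m F x).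
Proof.
move=> ax; set z := _ + _.
have zX : inner (G x) z (X x) = 0.
  have D0 : 'D_u (fun y => X y *m G y *m (X y)^T) x = 0.
    rewrite (derive_near u oU ax (G := cst 1%:M)) ?derive_cst// => y ay.
    by rewrite [LHS]mx11_scalar [X in X%:M]inner_xixi.
  move: D0; have dT := differentiable_trmx (dX ax).
  have dXG := differentiable_mulmx (dX ax) (dG ax).
  rewrite (derive_mulmx u dXG dT) (derive_mulmx u (dX ax) (dG ax)) (derive_trmx u (dX ax)).
  rewrite -(conn_metric h u ax) => /(congr1 (fun M : 'M[R]_1 => M 0 0)).
  have -> : inner (G x) z (X x) = 2^-1 * (inner (G x) z (X x) + inner (G x) (X x) z).
    by rewrite (symG z)//; field.
  rewrite /inner /z; move: ('D_u _ _) => p.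
  rewrite trmxD trmx_mul !(mulmxDl, mulmxDr) !mulmxA.
  by mx_entries => H; rewrite -(mulr0 2^-1) -{}H; congr (_ * _); ring.
have := @sas a X (@vector_smooth _ _ _ (xi S) a) x u ax.
rewrite (@cov_conn _ _ _ h a x u (X : 'rV[R]_(n.*2.+1) -> _) ax) -/z.
rewrite (_ : cov _ _ _ _ = 0); last first.
  rewrite cov_conn// xi_phi// mul0mx addr0.
  rewrite (derive_near u oU ax (G := cst 0)) ?derive_cst// => y ay.
  exact: xi_phi.
rewrite eta_xi// scale1r sub0r => /(congr1 (fun t => t *m F x)).
by rewrite mulNmx phi_phi// opprK mulmxBl -scalemxAl xi_phi// scaler0 sub0r.
Qed.

(** The integrability condition of [derive_phi]: its right-hand side is differentiated once more,
    and the two orders of differentiation are compared. *)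
Lemma riem_phi x u v : img a x ->
  F x *m riem u v x - riem u v x *m F x
  = G x *m (u *m F x)^T *m v - G x *m v^T *m (u *m F x)
    + G x *m u^T *m (v *m F x) - G x *m (v *m F x)^T *m u.
Proof.
move=> ax.
apply: (phi_curvature_algebra (X := X x) (conn_torsion h u v ax)).
have dc (w : 'rV[R]_(n.*2.+1)) : differentiable (cst w) x by exact: differentiable_cst.
have dcT (w : 'cV[R]_(n.*2.+1)) : differentiable (cst w : 'rV[R]_(n.*2.+1) -> _) x.
  exact: differentiable_cst.
have DX w : 'D_w X x = - (w *m F x) - X x *m conn w x.
  by rewrite -(cov_xi w ax) addrK.
have dXT := differentiable_trmx (dX ax).
have DF w w' : 'D_w ('D_w' F) x =
    'D_w (conn w') x *m F x + conn w' x *m 'D_w F x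
    - ('D_w F x *m conn w' x + F x *m 'D_w (conn w') x)
    + ('D_w G x *m w'^T *m X x + G x *m w'^T *m 'D_w X x)
    - ('D_w G x *m (X x)^T + G x *m ('D_w X x)^T) *m w'.
  have d1 := dgam w' ax; have d2 := dF ax; have d3 := dG ax; have d4 := dX ax.
  have E1 := derive_mulmx w d1 d2; have D1 := differentiable_mulmx d1 d2.
  have E2 := derive_mulmx w d2 d1; have D2 := differentiable_mulmx d2 d1.
  have E3 := derive_mulmx w d3 (dcT w'^T); have D3 := differentiable_mulmx d3 (dcT w'^T).
  have E4 := derive_mulmx w D3 d4; have D4 := differentiable_mulmx D3 d4.
  have E5 := derive_mulmx w d3 dXT; have D5 := differentiable_mulmx d3 dXT.
  have E6 := derive_mulmx w D5 (dc w'); have D6 := differentiable_mulmx D5 (dc w').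
  rewrite (derive_near w oU ax (G := fun y => conn w' y *m F y - F y *m conn w' y
    + G y *m w'^T *m X y - G y *m (X y)^T *m w')); last first.
    by move=> y ay; rewrite derive_phi// eta_lower.
  rewrite (derive_sub w (differentiable_add (differentiable_sub D1 D2) D4) D6).
  rewrite (derive_add w (differentiable_sub D1 D2) D4) (derive_sub w D1 D2).
  rewrite E1 E2 E4 E3 E6 E5 (derive_trmx w d4) !derive_cst.
  by rewrite !mulmx0 !addr0.
have := smooth_derive_sym v u oU (@endo_smooth _ _ _ (phi S) a) ax.
rewrite (DF v u) (DF u v) !DX !derive_phi// -(conn_metric h u ax) -(conn_metric h v ax).
by rewrite eta_lower.
Qed.

End SasakianChart.

Lemma row_outer (R : realType) m (G : 'M[R]_m) (w y v : 'rV[R]_m) :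
  w *m (G *m y^T *m v) = inner G w y *: v.
Proof.
rewrite !mulmxA; apply/matrixP => i j.
by rewrite ord1 [in LHS]mxE big_ord1 mx_scaleE.
Qed.

Section SpaceForm.
Variables (R : realType) (n : nat) (N : manifold R n.*2.+1) (h : metric N).
Variables (S : contact_metric h) (a : atlas N) (c : R) (x : 'rV[R]_(n.*2.+1)).
Hypotheses (sf : sasakian_space_form S c) (ax : img a x).
Implicit Types u v w z : 'rV[R]_(n.*2.+1).

Local Notation F := (phi S a x).
Local Notation X := (xi S a x).
Local Notation "<| u , v |>" := (inner (h a x) u v).
Local Notation riem u v := (riem h a u v x).

Let gC u v : <|u, v|> = <|v, u|>.
Proof. exact: Defs.metric_sym. Qed.
Let gF u v : <|u, v *m F|> = - <|u *m F, v|>.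
Proof. exact: inner_phir. Qed.
Let fC u v : <|u *m F, v|> = - <|v *m F, u|>.
Proof. by rewrite gC gF. Qed.
Let KC u v w z : <|w *m riem u v, z|> = - <|z *m riem u v, w|>.
Proof. exact: inner_riem_anti. Qed.

Lemma row_riem_phi u v w : w *m F *m riem u v - w *m riem u v *m F
  = <|w, u *m F|> *: v - <|w, v|> *: (u *m F) + <|w, u|> *: (v *m F)
    - <|w, v *m F|> *: u.
Proof.
rewrite -!mulmxA -mulmxBr (riem_phi sf.1 u v ax) mulmxBr mulmxDr mulmxBr.
by rewrite !row_outer.
Qed.

(** The difference [z] of the two sides is orthogonal to xi by skewness of the curvature, and phi z
    = 0 by the commutator formula at w = xi; so z = - phi^2 z = 0. *)
Lemma xi_riem u v : X *m riem u v = <|v, X|> *: u - <|u, X|> *: v.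
Proof.
apply/eqP; rewrite -subr_eq0; set z := _ - _.
have zX : <|z, X|> = 0.
  rewrite /z !inner_Bl !inner_Zl.
  have -> : <|X *m riem u v, X|> = 0 by have := KC u v X X; lra.
  ring.
have zF : z *m F = 0.
  have := row_riem_phi u v X.
  rewrite (xi_phi S ax) mul0mx !gF (xi_phi S ax) !inner_0l (gC X u) (gC X v) => E.
  rewrite /z !mulmxBl -!scalemxAl; apply/rowP => j; move/rowP/(_ j): E.
  by mx_entries; lra.
by have := phi_phi ax zX; rewrite zF mul0mx => /eqP; rewrite eq_sym oppr_eq0.
Qed.

(** The curvature tensor of N(c) with all terms containing eta dropped, hence a model for the
    curvature on ker eta only. *)
Definition space_form_tensor u v w z :=
  (c + 3) / 4 * (<|w, v|> * <|u, z|> - <|w, u|> * <|v, z|>)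
  + (c - 1) / 4 * (<|w, v *m F|> * <|u *m F, z|> - <|w, u *m F|> * <|v *m F, z|>
                   + 2 * <|u, v *m F|> * <|w *m F, z|>).

(** The space form hypothesis concerns unit vectors. Both sides are homogeneous of degree 4, so the
    claim follows by scaling [u] with the inverse of its length [s]. *)
Lemma phi_sectional_curvature u : <|u, X|> = 0 ->
  <|u *m F *m riem u (u *m F), u|> = c * <|u, u|> * <|u, u|>.
Proof.
move=> uX; have [->|u0] := eqVneq u 0; first by rewrite !mul0mx !inner_0l mulr0.
have uu : 0 < <|u, u|> by exact: metric_pos.
set s := Num.sqrt <|u, u|>.
have s0 : 0 < s by rewrite sqrtr_gt0.
have ss : s * s = <|u, u|> by rewrite -expr2 sqr_sqrtr// ltW.
have K4 r v : <|(r *: v) *m riem (r *: u) (r *: v), r *: u|> = r ^+ 4 * <|v *m riem u v, u|>.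
  rewrite -scalemxAl inner_Zl inner_Zr (inner_riem_pair h _ _ _ _ ax).
  rewrite -scalemxAl inner_Zl inner_Zr (inner_riem_pair h _ _ _ _ ax).
  by rewrite !exprS expr0; ring.
have u1 : <|s^-1 *: u, s^-1 *: u|> = 1.
  by rewrite inner_Zl inner_Zr -ss; field; rewrite gt_eqF.
have u1X : <|s^-1 *: u, X|> = 0 by rewrite inner_Zl uX mulr0.
have := sf.2 a x (s^-1 *: u) ax u1 u1X.
rewrite /sectional (curv_riem h _ _ _ ax) (inner_phi2 _ ax u1X) u1.
rewrite (inner_phi_self S _ ax) expr0n /= subr0 mulr1 divr1 -scalemxAl K4 => <-.
by rewrite -ss; field; rewrite gt_eqF.
Qed.

(** Kaehler polarization is applied to the Riemann tensor minus the model, with [D] the orthogonal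
    complement of xi and [J] = phi. *)
Lemma space_form_riem u v w z :
  <|u, X|> = 0 -> <|v, X|> = 0 -> <|w, X|> = 0 -> <|z, X|> = 0 ->
  <|w *m riem u v, z|> + <|u *m riem w v, z|>
  = space_form_tensor u v w z + space_form_tensor w v u z.
Proof.
move=> uX vX wX zX; apply/eqP; rewrite -subr_eq0; apply/eqP.
rewrite opprD addrACA.
apply: (@kaehler_polarization R _ (fun y => <|y, X|> = 0) (fun y => y *m F)
  (fun p q r t => <|r *m riem p q, t|> - space_form_tensor p q r t)) => //.
- by move=> p q pX qX; rewrite inner_Dl pX qX addr0.
- by move=> p pX; rewrite inner_Nl pX oppr0.
- by move=> p; exact: inner_phi_xi.
- by move=> p q; rewrite mulmxDl.
- by move=> p pX; exact: phi_phi.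
- move=> p q r r' t; rewrite /space_form_tensor !mulmxDl !inner_Dl; ring.
- move=> p q r t; rewrite riem_anti mulmxN inner_Nl /space_form_tensor.
  by rewrite !gF (fC q p); ring.
- move=> p q r t; rewrite KC /space_form_tensor !gF.
  rewrite (gC t q) (gC t p) (gC r q) (gC r p) (fC t q) (fC t p) (fC t r) (fC r q) (fC r p).
  by ring.
- move=> p q r t.
  have := congr1 (fun y => <|y, t|>) (riem_bianchi h p q r ax).
  rewrite /= !inner_Dl inner_0l.
  have Z (k1 k2 k3 t1 t2 t3 : R) : t1 + t2 + t3 = 0 -> k1 + k2 + k3 = 0 ->
    (k1 - t1) + (k2 - t2) + (k3 - t3) = 0 by lra.
  apply: Z; rewrite /space_form_tensor !gF.
  rewrite (gC q p) (gC r q) (gC r p) (fC q p) (fC r q) (fC r p).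
  by ring.
(* The defect of phi-invariance of the curvature, given by [row_riem_phi], cancels against that of
   the model. *)
- move=> p q r t rX tX.
  have tF u1 : <|u1 *m F, t *m F|> = <|u1, t|>.
    by rewrite gC inner_phi2// gC.
  have rF u1 : <|r *m F, u1 *m F|> = <|r, u1|> by rewrite inner_phi2.
  have := congr1 (fun y => <|y, t *m F|>) (row_riem_phi p q r).
  rewrite /= !(inner_Dl, inner_Nl, inner_Zl) !tF /space_form_tensor !tF !rF !gF => /eqP.
  rewrite subr_eq => /eqP ->.
  by field.
(* On a phi-plane the model gives (c + 3) / 4 + 3 (c - 1) / 4 = c. *)
- move=> p pX; rewrite (phi_sectional_curvature pX) /space_form_tensor.
  have pp u1 : <|p *m F, u1 *m F|> = <|p, u1|> by rewrite inner_phi2.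
  have Fp : <|p *m F, p|> = 0 by rewrite gC (inner_phi_self S _ ax).
  rewrite !pp (phi_phi ax pX) inner_Nl inner_Nr Fp (inner_phi_self S _ ax).
  by field.
Qed.

(* The curvature term of the bitension field, polarized. *)
Lemma space_form_curv u v w :
  <|u, X|> = 0 -> <|v, X|> = 0 -> <|w, X|> = 0 ->
  <|u, v|> = 0 -> <|w, v|> = 0 -> <|u, w *m F|> = 0 ->
  curv (h a) x u v w + curv (h a) x w v u
  = - ((c + 3) / 2 * <|u, w|>) *: v
    - (3 * (c - 1) / 4) *: (<|w *m F, v|> *: (u *m F) + <|u *m F, v|> *: (w *m F)).
Proof.
move=> uX vX wX uv wv uw; rewrite !(curv_riem h _ _ _ ax).
apply: (inner_inj (metric_unit h ax)) => z.
(* The model is available only on ker eta, so the xi component of the test vector is split off; it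
   contributes nothing, because by [xi_riem] the curvature preserves ker eta. *)
pose z' := z - <|z, X|> *: X.
have z'X : <|z', X|> = 0.
  by rewrite inner_Bl inner_Zl inner_xixi// mulr1 subrr.
rewrite -(subrK (<|z, X|> *: X) z) -/z'.
have E := space_form_riem uX vX wX z'X.
have KX p q r : <|p, X|> = 0 -> <|q, X|> = 0 -> <|r *m riem p q, X|> = 0.
  by move=> pX qX; rewrite KC xi_riem pX qX !scale0r subrr inner_0l oppr0.
clearbody z'; rewrite [LHS]inner_Dr [X in _ + X = _]inner_Zr.
rewrite !(inner_Dl _ (w *m _)) E (KX u v w uX vX) (KX w v u wX vX) addr0 mulr0 addr0.
rewrite !(inner_Dl, inner_Nl, inner_Zl, inner_Dr, inner_Zr) vX !inner_phi_xi//.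
rewrite /space_form_tensor !gF.
have uw' : <|u *m F, w|> = 0 by rewrite fC gC uw oppr0.
by rewrite (gC w u) uv wv uw' (fC w u) uw'; field.
Qed.

End SpaceForm.

(** Vanishing torsion exchanges direction and argument, and linearity in the argument is built into
    the matrix. *)
Lemma conn_dir (R : realType) m (N : manifold R m) (h : metric N) b x u : img b x ->
  conn h b u x = \sum_k u 0 k *: conn h b (basis_vec R k) x.
Proof.
move=> bx; apply: eq_row_action => v; rewrite (conn_torsion h u v bx).
rewrite {1}[u]row_basis mulmx_suml mulmx_sumr; apply: eq_bigr => k _.
by rewrite -scalemxAl -scalemxAr (conn_torsion h _ v bx).
Qed.

(** * Isometric immersions *)

Section Immersion.
Variables (R : realType) (n m : nat) (M : manifold R n) (N : manifold R m).
Variables (g : metric M) (h : metric N) (psi : M -> N) (a : atlas M) (b : atlas N).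
Hypothesis iso : isometric_immersion g h psi.
Implicit Types (x u v w : 'rV[R]_n) (V W : 'rV[R]_n -> 'rV[R]_m).

Local Notation f := (loc psi a b).
Local Notation U := (loc_dom psi a b).
Local Notation e_ i := (basis_vec R i).

Lemma loc_dom_img x : U x -> img a x.
Proof. by case. Qed.

Lemma loc_img x : U x -> img b (f x).
Proof. by case=> _ bx; exists (psi (param a x)). Qed.

Lemma loc_dom_open : open U.
Proof.
rewrite openE => x [ax bx]; apply: filterI.
  by apply: open_nbhs_nbhs; split=> //; exact: img_open.
apply: (@continuous_comp _ _ _ (param a) psi x).
- exact: param_continuous.
- exact: iso.1.1.
- by apply: open_nbhs_nbhs; split=> //; exact: dom_open.
Qed.

Lemma loc_smooth : smooth_on U f.
Proof. exact: iso.1.2. Qed.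

Let sf := loc_smooth.
Let oU := loc_dom_open.

Definition jac x : 'M[R]_(n, m) := \matrix_i 'D_(e_ i) f x.

Lemma derive_loc u x : U x -> 'D_u f x = u *m jac x.
Proof.
move=> Ux; rewrite {1}[u]row_basis derive_dir_sum; last exact: smooth_on_differentiable sf Ux.
by rewrite mulmx_sum_row; apply: eq_bigr => i _; rewrite rowK.
Qed.

Lemma differentiable_loc x : U x -> differentiable f x.
Proof. exact: smooth_on_differentiable. Qed.

Lemma differentiable_jac x : U x -> differentiable jac x.
Proof.
move=> Ux; apply: differentiable_mx => i j.
have d := smooth_on_differentiable (smooth_on_derive (e_ i) sf) Ux.
under eq_fun do rewrite mxE.
exact: differentiable_entry d.
Qed.

Lemma derive_derive_loc u v x : U x -> 'D_u ('D_v f) x = v *m 'D_u jac x.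
Proof.
move=> Ux; rewrite (derive_near u oU Ux (G := fun y => v *m jac y)); last first.
  exact: derive_loc.
rewrite derive_mulmx; [|exact: differentiable_cst|exact: differentiable_jac].
by rewrite derive_cst mul0mx add0r.
Qed.

Lemma differentiable_derive_jac u x : U x -> differentiable ('D_u jac) x.
Proof.
move=> Ux; apply: differentiable_mx => i j.
apply: (differentiable_on_eq oU Ux (G := fun y => 'D_u ('D_(e_ i) f) y 0 j)).
  by move=> y Uy; rewrite derive_derive_loc// -rowE mxE.
apply: differentiable_entry.
exact: (smooth_on_differentiable (smooth_on_derive u (smooth_on_derive (e_ i) sf)) Ux).
Qed.

Lemma derive_jac_sym u v x : U x -> v *m 'D_u jac x = u *m 'D_v jac x.
Proof.
move=> Ux; apply: etrans (esym (derive_derive_loc u v Ux)) _.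
exact: etrans (smooth_derive_sym u v oU sf Ux) (derive_derive_loc v u Ux).
Qed.

Definition hloc x : 'M[R]_m := h b (f x).

Lemma differentiable_pull (W : normedModType R) (T : 'rV[R]_m -> W) x :
  U x -> smooth_on (img b) T -> differentiable (fun y => T (f y)) x.
Proof.
move=> Ux sT; apply: (differentiable_comp (differentiable_loc Ux)).
exact: (smooth_on_differentiable sT (loc_img Ux)).
Qed.

Lemma derive_pull (W : normedModType R) (T : 'rV[R]_m -> W) u x :
  U x -> smooth_on (img b) T ->
  'D_u (fun y => T (f y)) x = 'D_(u *m jac x) T (f x).
Proof.
move=> Ux sT; rewrite (derive_comp u (differentiable_loc Ux)).
  by rewrite derive_loc.
exact: (smooth_on_differentiable sT (loc_img Ux)).
Qed.

Definition conn_along u x : 'M[R]_m := conn h b (u *m jac x) (f x).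

Lemma cov_along_conn u V x : U x ->
  cov_along (h b) f u V x = 'D_u V x + V x *m conn_along u x.
Proof.
by move=> Ux; rewrite /cov_along derive_loc// (christoffel_conn h _ _ (loc_img Ux)).
Qed.

(** The direction [u *m jac y] moves with [y], so it is expanded in the fixed basis, where
    [differentiable_conn] applies. *)
Lemma differentiable_conn_along u x : U x -> differentiable (conn_along u) x.
Proof.
move=> Ux.
apply: (differentiable_on_eq oU Ux
  (G := fun y => \sum_k (u *m jac y) 0 k *: conn h b (e_ k) (f y))).
  by move=> y Uy; rewrite /conn_along (conn_dir h _ (loc_img Uy)).
apply: differentiable_bigsum => k _.
apply: differentiable_mx => i j; under eq_fun do rewrite mxE.
apply: differentiableM.
  apply: differentiable_entry; apply: differentiable_mulmx.
    exact: differentiable_cst.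
  exact: differentiable_jac.
apply: differentiable_entry.
apply: (@differentiable_comp _ _ _ _ f (conn h b (e_ k))).
  exact: differentiable_loc.
exact: differentiable_conn (loc_img Ux).
Qed.

Lemma conn_along_torsion u v x : U x ->
  v *m jac x *m conn_along u x = u *m jac x *m conn_along v x.
Proof. by move=> Ux; exact: conn_torsion (loc_img Ux). Qed.

Lemma differentiable_hloc x : U x -> differentiable hloc x.
Proof. by move=> Ux; apply: differentiable_pull => //; exact: metric_smooth. Qed.

Lemma derive_hloc u x : U x ->
  'D_u hloc x = conn_along u x *m hloc x + hloc x *m (conn_along u x)^T.
Proof.
move=> Ux; rewrite (derive_pull u Ux (@metric_smooth _ _ _ h b)).
by rewrite (conn_metric h _ (loc_img Ux)).
Qed.

Lemma hloc_sym x (p q : 'rV[R]_m) : U x -> inner (hloc x) p q = inner (hloc x) q p.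
Proof. by move=> Ux; exact: Defs.metric_sym (loc_img Ux). Qed.

Lemma differentiable_inner V W x : U x -> differentiable V x -> differentiable W x ->
  differentiable (fun y => inner (hloc y) (V y) (W y)) x.
Proof.
move=> Ux dV dW; apply: differentiable_entry; apply: differentiable_mulmx.
  by apply: differentiable_mulmx => //; exact: differentiable_hloc.
exact: differentiable_trmx.
Qed.

Lemma derive_inner V W u x : U x -> differentiable V x -> differentiable W x ->
  'D_u (fun y => inner (hloc y) (V y) (W y)) x
  = inner (hloc x) ('D_u V x + V x *m conn_along u x) (W x)
    + inner (hloc x) (V x) ('D_u W x + W x *m conn_along u x).
Proof.
move=> Ux dV dW; have dH := differentiable_hloc Ux.
have dVH := differentiable_mulmx dV dH; have dWT := differentiable_trmx dW.
rewrite /inner (derive_entry u 0 0 (differentiable_mulmx dVH dWT)).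
rewrite (derive_mulmx u dVH dWT) (derive_mulmx u dV dH) (derive_trmx u dW).
rewrite derive_hloc// -mx_addE; congr ((_ : 'M[R]_1) 0 0).
move: ('D_u V x) ('D_u W x) => p q; mx_lin.
Qed.

Lemma isometric x : U x -> jac x *m hloc x *m (jac x)^T = g a x.
Proof.
move=> Ux; apply: inner_matrixP => u v.
rewrite -(iso.2 a b x u v Ux) !derive_loc// /inner trmx_mul !mulmxA.
by [].
Qed.

Lemma inner_isometric x u v : U x ->
  inner (hloc x) (u *m jac x) (v *m jac x) = inner (g a x) u v.
Proof. by move=> Ux; rewrite -isometric// /inner trmx_mul !mulmxA. Qed.

Definition normal_proj x : 'M[R]_m :=
  1%:M - hloc x *m (jac x)^T *m invmx (g a x) *m jac x.

Let ug x : U x -> g a x \in unitmx.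
Proof. by move=> Ux; exact: metric_unit (loc_dom_img Ux). Qed.

Lemma tangential_partE x (w : 'rV[R]_m) : U x ->
  tangential_part (g a) (h b) f x w = w *m hloc x *m (jac x)^T *m invmx (g a x).
Proof.
move=> Ux; rewrite /tangential_part /raise; congr (_ *m _).
apply/rowP => k; rewrite mxE /inner derive_loc//.
by rewrite trmx_mul mulmxA /basis_vec trmx_delta -colE mxE.
Qed.

Lemma normal_partE x (w : 'rV[R]_m) : U x ->
  normal_part (g a) (h b) f x w = w *m normal_proj x.
Proof.
move=> Ux; rewrite /normal_part derive_loc// tangential_partE// /normal_proj.
by rewrite mulmxBr mulmx1 !mulmxA.
Qed.

Lemma jac_normal_proj x : U x -> jac x *m normal_proj x = 0.
Proof.
move=> Ux; rewrite /normal_proj mulmxBr mulmx1 !mulmxA isometric// mulmxV ?ug//.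
by rewrite mul1mx subrr.
Qed.

Lemma normal_proj_id x (w : 'rV[R]_m) : U x ->
  (forall u, inner (hloc x) w (u *m jac x) = 0) -> w *m normal_proj x = w.
Proof.
move=> Ux wn; rewrite /normal_proj mulmxBr mulmx1 !mulmxA.
suff -> : w *m hloc x *m (jac x)^T = 0 by rewrite !mul0mx subr0.
apply/rowP => k; rewrite [RHS]mxE -(wn (e_ k)) /inner trmx_mul mulmxA.
by rewrite /basis_vec trmx_delta -colE [RHS]mxE.
Qed.

Lemma inner_normal_proj x (p q : 'rV[R]_m) : U x ->
  (forall u, inner (hloc x) q (u *m jac x) = 0) ->
  inner (hloc x) (p *m normal_proj x) q = inner (hloc x) p q.
Proof.
move=> Ux qn; rewrite /normal_proj mulmxBr mulmx1 inner_Bl !mulmxA.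
by rewrite [X in _ - X]hloc_sym// qn subr0.
Qed.

Lemma normal_decomposition x (w : 'rV[R]_m) t : U x ->
  (forall k, inner (hloc x) w (e_ k *m jac x) = inner (g a x) t (e_ k)) ->
  w = w *m normal_proj x + t *m jac x.
Proof.
move=> Ux wt; rewrite /normal_proj mulmxBr mulmx1 !mulmxA.
suff -> : w *m hloc x *m (jac x)^T = t *m g a x by rewrite mulmxK ?ug// subrK.
apply/rowP => k; rewrite -inner_row -wt /inner trmx_mul mulmxA.
by rewrite /basis_vec trmx_delta -colE [RHS]mxE.
Qed.

End Immersion.

(** * Traces of bilinear maps *)

Section Trace.
Variables (R : realType) (n : nat) (W : lmodType R).
Implicit Types (P A : 'M[R]_n) (T : 'rV[R]_n -> 'rV[R]_n -> W).

(** Generalizes [mtrace] to an arbitrary matrix [P], since differentiating a metric trace produces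
    the derivative of the inverse metric in place of the inverse metric. *)
Definition contract P T : W :=
  \sum_(i < n) \sum_(j < n) P i j *: T (basis_vec R i) (basis_vec R j).

Lemma mtraceE P T : mtrace P T = contract (invmx P) T.
Proof. by []. Qed.

Lemma eq_contract P T T' : (forall u v, T u v = T' u v) -> contract P T = contract P T'.
Proof. by move=> TT; do 2!apply: eq_bigr => ? _; rewrite TT. Qed.

Lemma contractD P T T' :
  contract P (fun u v => T u v + T' u v) = contract P T + contract P T'.
Proof.
rewrite /contract -big_split; apply: eq_bigr => i _ /=; rewrite -big_split.
by apply: eq_bigr => j _ /=; rewrite scalerDr.
Qed.

Lemma contractZ P r T : contract P (fun u v => r *: T u v) = r *: contract P T.
Proof.
rewrite /contract scaler_sumr; apply: eq_bigr => i _; rewrite scaler_sumr.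
by apply: eq_bigr => j _; rewrite !scalerA mulrC.
Qed.

Lemma contractN P T : contract P (fun u v => - T u v) = - contract P T.
Proof. by rewrite -scaleN1r -contractZ; apply: eq_contract => u v; rewrite scaleN1r. Qed.

Lemma contractDm P P' T : contract (P + P') T = contract P T + contract P' T.
Proof.
rewrite /contract -big_split; apply: eq_bigr => i _ /=; rewrite -big_split.
by apply: eq_bigr => j _ /=; rewrite mxE scalerDl.
Qed.

Lemma contract0 T : contract 0 T = 0.
Proof. by do 2!rewrite /contract big1// => ? _; rewrite mxE scale0r. Qed.

(** Moves connection matrices from the arguments of [T] into [P], where they can cancel against the
    derivative of the inverse metric. *)
Lemma contract_mul_l P A T : (forall v, linear (T ^~ v)) ->
  contract P (fun u v => T (u *m A) v) = contract (A^T *m P) T.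
Proof.
move=> Tl; have TS v (F : 'I_n -> 'rV[R]_n) c :
    T (\sum_k c k *: F k) v = \sum_k c k *: T (F k) v.
  have T0 : T 0 v = 0.
    have := Tl v 1 0 0; rewrite scaler0 addr0 scale1r -[LHS]addr0.
    by move=> /addrI.
  elim/big_rec2: _ => [//|k y y' _ <-]; exact: Tl.
rewrite /contract [LHS]exchange_big [RHS]exchange_big /=; apply: eq_bigr => j _.
under eq_bigr => i _ do rewrite -rowE [row i A]row_basis TS scaler_sumr.
rewrite exchange_big /=; apply: eq_bigr => k _.
rewrite mxE scaler_suml; apply: eq_bigr => i _.
by rewrite scalerA !mxE mulrC.
Qed.

Lemma contract_tr P T : contract P^T T = contract P (fun u v => T v u).
Proof.
rewrite /contract exchange_big; apply: eq_bigr => i _; apply: eq_bigr => j _.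
by rewrite mxE.
Qed.

Lemma contract_mul_r P A T : (forall u, linear (T u)) ->
  contract P (fun u v => T u (v *m A)) = contract (P *m A) T.
Proof.
move=> Tl; rewrite -[P in RHS]trmxK -[A in RHS]trmxK -trmx_mul contract_tr.
by rewrite -contract_mul_l// contract_tr.
Qed.

End Trace.

Lemma contract_mulmx (R : realType) n p q r (P : 'M[R]_n)
    (T : 'rV[R]_n -> 'rV[R]_n -> 'M[R]_(p, q)) (A : 'M[R]_(q, r)) :
  contract P T *m A = contract P (fun u v => T u v *m A).
Proof.
rewrite /contract mulmx_suml; apply: eq_bigr => i _; rewrite mulmx_suml.
by apply: eq_bigr => j _; rewrite -scalemxAl.
Qed.

Lemma contract_scaler (R : realType) n (W : lmodType R) (P : 'M[R]_n)
    (s : 'rV[R]_n -> 'rV[R]_n -> R) (w : W) :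
  contract P (fun u v => s u v *: w) = contract P (s : _ -> _ -> R^o) *: w.
Proof.
rewrite /contract scaler_suml; apply: eq_bigr => i _; rewrite scaler_suml.
by apply: eq_bigr => j _; rewrite scalerA.
Qed.

Lemma derive_scale_mx (R : realType) (V : normedModType R) p q (s : V -> R)
    (F : V -> 'M[R]_(p, q)) x v :
  differentiable s x -> differentiable F x ->
  differentiable (fun y => s y *: F y) x /\
  'D_v (fun y => s y *: F y) x = 'D_v s x *: F x + s x *: 'D_v F x.
Proof.
move=> ds dF; have d : differentiable (fun y => s y *: F y) x.
  apply: differentiable_mx => i j; under eq_fun do rewrite mxE.
  by apply: differentiableM => //; exact: differentiable_entry.
split=> //; apply/matrixP => i j; rewrite -(derive_entry v i j d).
under eq_fun do rewrite mxE.
rewrite (derive_mul v ds (differentiable_entry i j dF)) (derive_entry v i j dF).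
by rewrite !mxE.
Qed.

Lemma inner_contract (R : realType) n m (G : 'M[R]_m) (P : 'M[R]_n) T w :
  inner G w (contract P T) = \sum_i \sum_j P i j * inner G w (T (basis_vec R i) (basis_vec R j)).
Proof.
rewrite /contract inner_sumr; apply: eq_bigr => i _; rewrite inner_sumr.
by apply: eq_bigr => j _; rewrite inner_Zr.
Qed.

Lemma derive_invmx (R : realType) n (V : normedModType R) (g : V -> 'M[R]_n)
    (U : set V) x v : open U -> U x -> (forall y, U y -> g y \in unitmx) ->
  differentiable g x ->
  'D_v (fun y => invmx (g y)) x = - (invmx (g x) *m 'D_v g x *m invmx (g x)).
Proof.
move=> oU Ux ug dg; have dI := differentiable_invmx oU Ux ug dg.
have : 'D_v (fun y => invmx (g y) *m g y) x = 0.
  rewrite (derive_near v oU Ux (G := cst 1%:M)) ?derive_cst// => y Uy.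
  by rewrite mulVmx// ug.
rewrite (derive_mulmx v dI dg) => /eqP; rewrite addr_eq0 => /eqP E.
by rewrite -[LHS](mulmxK (ug x Ux)) E mulNmx.
Qed.

(** * Second fundamental form and mean curvature in a chart *)

Section SecondForm.
Variables (R : realType) (n m : nat) (M : manifold R n) (N : manifold R m).
Variables (g : metric M) (h : metric N) (psi : M -> N) (a : atlas M) (b : atlas N).
Hypothesis iso : isometric_immersion g h psi.
Implicit Types (x u v w : 'rV[R]_n).

Local Notation f := (loc psi a b).
Local Notation U := (loc_dom psi a b).
Local Notation e_ i := (basis_vec R i).
Local Notation jac := (jac psi a b).
Local Notation hloc := (hloc h psi a b).
Local Notation Om := (conn_along h psi a b).
Local Notation Ga := (conn g a).

Let oU : open U.
Proof. exact: loc_dom_open iso. Qed.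

Definition hess u x : 'M[R]_(n, m) := 'D_u jac x + jac x *m Om u x.

Lemma hess_sym u v x : U x -> v *m hess u x = u *m hess v x.
Proof.
move=> Ux; rewrite !mulmxDr (derive_jac_sym iso u v Ux) !mulmxA.
by rewrite (conn_along_torsion h u v Ux).
Qed.

Lemma derive_metric u x : U x -> 'D_u (g a) x
  = hess u x *m hloc x *m (jac x)^T + jac x *m hloc x *m (hess u x)^T.
Proof.
move=> Ux; have dJ := differentiable_jac iso Ux; have dH := differentiable_hloc iso Ux.
have dJT := differentiable_trmx dJ; have dJH := differentiable_mulmx dJ dH.
rewrite (derive_near u oU Ux (G := fun y => jac y *m hloc y *m (jac y)^T)); last first.
  by move=> y Uy; rewrite (isometric iso).
rewrite (derive_mulmx u dJH dJT) (derive_mulmx u dJ dH) (derive_trmx u dJ).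
rewrite (derive_hloc iso u Ux) /hess.
by move: ('D_u _ _) => p; mx_lin.
Qed.

(** The tangential half of the Gauss formula. [P] is symmetric in its first two slots and its
    symmetrization in the last two is the derivative of the metric, so the Koszul formula identifies
    it with the connection of M. *)
Lemma inner_hess u v w x : U x ->
  inner (hloc x) (v *m hess u x) (w *m jac x) = inner (g a x) (v *m Ga u x) w.
Proof.
move=> Ux; have ax := loc_dom_img Ux.
pose P p q r := inner (hloc x) (q *m hess p x) (r *m jac x).
have Psym p q r : P p q r = P q p r by rewrite /P hess_sym.
have PD p q r : inner ('D_p (g a) x) q r = P p q r + P p r q.
  rewrite derive_metric// inner_addG /P [X in _ = _ + X](hloc_sym h _ _ Ux).
  by rewrite /inner !trmx_mul !mulmxA.
rewrite -(christoffel_conn g _ _ ax) (inner_christoffel g _ _ _ ax) /koszul !PD.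
rewrite -/(P u v w) (Psym v u w) (Psym w u v) (Psym w v u); move: (P _ _ _) (P _ _ _) (P _ _ _).
by move=> p q r; field.
Qed.

(** The Hessian of the immersion as a matrix. By [inner_hess] it is already normal, so it represents
    both [hessian_map] and [second_form]. *)
Definition sform u x : 'M[R]_(n, m) := hess u x - Ga u x *m jac x.

Lemma sform_sym u v x : U x -> v *m sform u x = u *m sform v x.
Proof.
move=> Ux; rewrite !mulmxBr (hess_sym u v Ux) !mulmxA.
by rewrite (conn_torsion g u v (loc_dom_img Ux)).
Qed.

Lemma sform_normal u v w x : U x ->
  inner (hloc x) (v *m sform u x) (w *m jac x) = 0.
Proof.
move=> Ux; rewrite mulmxBr mulmxA inner_Bl.
by rewrite (inner_hess _ _ _ Ux) (inner_isometric iso _ _ Ux) subrr.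
Qed.

Lemma cov_along_derive u v x : U x -> cov_along (h b) f u ('D_v f) x = v *m hess u x.
Proof.
move=> Ux; rewrite (cov_along_conn iso _ _ Ux) (derive_derive_loc iso u v Ux).
by rewrite (derive_loc iso v Ux) mulmxDr mulmxA.
Qed.

Lemma second_formE u v x : U x ->
  second_form (g a) (h b) f u v x = v *m sform u x.
Proof.
move=> Ux; rewrite /second_form cov_along_derive// (normal_partE iso _ Ux).
rewrite -[hess u x](subrK (Ga u x *m jac x)) -/(sform u x).
rewrite (mulmxDr v) (mulmxDl (v *m sform u x)) (mulmxA v).
rewrite (normal_proj_id g Ux); last by move=> w; exact: sform_normal.
by rewrite -mulmxA (jac_normal_proj iso Ux) mulmx0 addr0.
Qed.

Lemma hessian_mapE u v x : U x ->
  hessian_map (g a) (h b) f u v x = v *m sform u x.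
Proof.
move=> Ux; rewrite /hessian_map cov_along_derive// (derive_loc iso _ Ux).
by rewrite (cov_cst g _ _ (loc_dom_img Ux)) -mulmxA -mulmxBr.
Qed.

Lemma differentiable_hess u x : U x -> differentiable (hess u) x.
Proof.
move=> Ux; apply: differentiable_add; first exact: (differentiable_derive_jac iso).
by apply: differentiable_mulmx; [exact: (differentiable_jac iso)|exact: (differentiable_conn_along iso)].
Qed.

Lemma differentiable_sform u x : U x -> differentiable (sform u) x.
Proof.
move=> Ux; apply: differentiable_sub; first exact: differentiable_hess.
apply: differentiable_mulmx; last exact: (differentiable_jac iso).
exact: differentiable_conn (loc_dom_img Ux).
Qed.

Lemma differentiable_metric_inv x : U x -> differentiable (fun y => invmx (g a y)) x.
Proof.
move=> Ux; apply: (differentiable_invmx oU Ux).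
  by move=> y Uy; exact: metric_unit (loc_dom_img Uy).
exact: smooth_on_differentiable (@metric_smooth _ _ _ g a) (loc_dom_img Ux).
Qed.

Lemma derive_metric_inv u x : U x ->
  'D_u (fun y => invmx (g a y)) x
  = - (invmx (g a x) *m Ga u x + (Ga u x)^T *m invmx (g a x)).
Proof.
move=> Ux; have ax := loc_dom_img Ux; have ug := metric_unit g ax.
have oa : open (img a) by exact: img_open.
have da := smooth_on_differentiable (@metric_smooth _ _ _ g a) ax.
rewrite (derive_invmx u oa ax (fun y => @metric_unit _ _ _ g a y) da).
rewrite -(conn_metric g _ ax) mulmxDr mulmxDl !mulmxA (mulmxK ug) (mulVmx ug) mul1mx.
by [].
Qed.

Local Notation H := (mean_curvature (g a) (h b) f).

Lemma mean_curvatureE x : U x ->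
  H x = n%:R^-1 *: contract (invmx (g a x)) (fun u v => v *m sform u x).
Proof.
move=> Ux; rewrite /mean_curvature mtraceE; congr (_ *: _).
by apply: eq_contract => u v; exact: second_formE.
Qed.

Lemma tensionE x : (0 < n)%N -> U x ->
  tension (g a) (h b) f x = n%:R *: H x.
Proof.
move=> n0 Ux; rewrite mean_curvatureE// scalerA divff ?pnatr_eq0 ?gtn_eqF// scale1r.
by rewrite /tension mtraceE; apply: eq_contract => u v; exact: hessian_mapE.
Qed.

Lemma mean_curvature_normal x w : U x -> inner (hloc x) (H x) (w *m jac x) = 0.
Proof.
move=> Ux; rewrite mean_curvatureE// inner_Zl /contract inner_suml big1 ?mulr0// => i _.
by rewrite inner_suml big1// => j _; rewrite inner_Zl sform_normal// mulr0.
Qed.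

Lemma differentiable_mean_curvature x : U x -> differentiable H x.
Proof.
move=> Ux; apply: (differentiable_on_eq oU Ux (G := fun y => n%:R^-1 *:
  contract (invmx (g a y)) (fun u v => v *m sform u y))).
  exact: mean_curvatureE.
apply: differentiable_mx => i j.
under eq_fun do rewrite mxE summxE.
apply: differentiableM; first exact: differentiable_cst.
apply: differentiable_bigsum => k _.
under eq_fun do rewrite summxE.
apply: differentiable_bigsum => l _.
under eq_fun do rewrite mxE.
apply: differentiableM; apply: differentiable_entry.
  exact: differentiable_metric_inv.
apply: differentiable_mulmx; first exact: differentiable_cst.
exact: differentiable_sform.
Qed.

Lemma derive_mean_curvature u x : U x -> 'D_u H x
  = n%:R^-1 *: (contract (- (invmx (g a x) *m Ga u x + (Ga u x)^T *m invmx (g a x)))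
                  (fun v w => w *m sform v x)
                + contract (invmx (g a x)) (fun v w => w *m 'D_u (sform v) x)).
Proof.
move=> Ux; have dG := differentiable_metric_inv Ux.
have dw (w : 'rV[R]_n) v : differentiable (fun y => w *m sform v y) x.
  by apply: differentiable_mulmx; [exact: differentiable_cst|exact: differentiable_sform].
have Dw (w : 'rV[R]_n) v : 'D_u (fun y => w *m sform v y) x = w *m 'D_u (sform v) x.
  rewrite derive_mulmx; [|exact: differentiable_cst|exact: differentiable_sform].
  by rewrite derive_cst mul0mx add0r.
apply/rowP => k.
rewrite -(derive_entry u 0 k (differentiable_mean_curvature Ux)).
rewrite (derive_near u oU Ux (G := fun y => n%:R^-1 * \sum_i \sum_j
  invmx (g a y) i j * (e_ j *m sform (e_ i) y) 0 k)); last first.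
  move=> y Uy; rewrite mean_curvatureE// mxE summxE; congr (_ * _).
  by apply: eq_bigr => i _; rewrite summxE; apply: eq_bigr => j _; rewrite mxE.
have d1 i j : differentiable (fun y => invmx (g a y) i j * (e_ j *m sform (e_ i) y) 0 k) x.
  by apply: differentiableM; apply: differentiable_entry.
rewrite (@derive_mul _ _ (cst _)); [|exact: differentiable_cst|]; last first.
  by do 2!apply: differentiable_bigsum => ? _.
rewrite derive_cst mul0r add0r derive_bigsum; last first.
  by move=> i _; apply: differentiable_bigsum.
rewrite [RHS]mxE /cst; congr (_ * _).
rewrite mxE /contract !summxE -big_split; apply: eq_bigr => i _ /=.
rewrite derive_bigsum; last by move=> j _; exact: d1.
rewrite !summxE -big_split; apply: eq_bigr => j _ /=.
rewrite (derive_mul u (differentiable_entry i j dG) (differentiable_entry 0 k (dw _ _))).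
rewrite (derive_entry u i j dG) (derive_entry u 0 k (dw _ _)) Dw derive_metric_inv//.
by rewrite !mx_scaleE.
Qed.

End SecondForm.

Lemma gram_eq (R : realType) p q m (G : 'M[R]_m) (A : 'M[R]_(p, m)) (C : 'M[R]_(q, m))
    (D : 'M[R]_(p, q)) :
  (forall (u : 'rV_p) (v : 'rV_q), inner G (u *m A) (v *m C) = (u *m D *m v^T) 0 0) ->
  A *m G *m C^T = D.
Proof.
move=> AC; apply/matrixP => i j; have := AC (basis_vec R i) (basis_vec R j).
have E (B : 'M[R]_(p, q)) : (basis_vec R i *m B *m (basis_vec R j)^T) 0 0 = B i j.
  by rewrite /basis_vec -rowE trmx_delta -colE !mxE.
by rewrite E /inner trmx_mul => <-; rewrite -[LHS]E !mulmxA.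
Qed.

(* The tangent space, its image under phi and xi have total dimension 2n + 1. *)
Lemma legendrian_frame (R : realType) n (h F : 'M[R]_(n.*2.+1)) (g : 'M[R]_n)
    (J : 'M[R]_(n, n.*2.+1)) (X w : 'rV[R]_(n.*2.+1)) :
  h \in unitmx -> g \in unitmx ->
  J *m h *m J^T = g -> J *m F *m h *m (J *m F)^T = g ->
  X *m h *m X^T = 1%:M -> J *m h *m (J *m F)^T = 0 -> J *m F *m h *m J^T = 0 ->
  J *m h *m X^T = 0 -> X *m h *m J^T = 0 ->
  J *m F *m h *m X^T = 0 -> X *m h *m (J *m F)^T = 0 ->
  w *m h *m J^T = 0 -> w *m h *m X^T = 0 ->
  w = w *m h *m (J *m F)^T *m invmx g *m (J *m F).
Proof.
move=> uh ug JJ KK XX JK KJ JX XJ KX XK wJ wX.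
set K := J *m F in KK JK KJ KX XK *.
pose A := col_mx (col_mx J K) X.
have freeA : row_free A.
  apply/row_freeP.
  (* The h-dual of the frame: the three blocks are mutually orthogonal, with Gram matrices [g], [g]
     and 1. *)
  exists (row_mx (row_mx (h *m J^T *m invmx g) (h *m K^T *m invmx g)) (h *m X^T)).
  rewrite !mul_col_row mul_col_mx mul_mx_row !mulmxA.
  rewrite JJ KK XX JK KJ JX XJ KX XK !mul0mx mulmxV//.
  by rewrite col_mx0 row_mx0 -!scalar_mx_block.
have : row_full A.
  by rewrite /row_full (eqP freeA) addnn addn1.
move=> /row_fullP[C CA].
set p := w *m h *m K^T *m invmx g.
apply/eqP; rewrite -subr_eq0; set z := _ - _.
have zE q (Y : 'M[R]_(_, q)) : z *m h *m Y = w *m h *m Y - p *m (K *m h *m Y).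
  by rewrite /z !mulmxBl !mulmxA.
have zA : z *m h *m A^T = 0.
  rewrite !tr_col_mx !mul_mx_row !zE wJ wX KJ KX KK !mulmx0 !subr0 mulmxKV//.
  by rewrite subrr !row_mx0.
have : z *m h = 0 by rewrite -[z *m h]mulmx1 -trmx1 -CA trmx_mul mulmxA zA mul0mx.
by move=> /(congr1 (fun M => M *m invmx h)); rewrite mulmxK// mul0mx => ->.
Qed.

(** * Integral C-parallel submanifolds *)

Section CParallel.
Variables (R : realType) (n : nat) (N : manifold R n.*2.+1) (h : metric N).
Variables (S : contact_metric h) (sas : sasakian S).
Variables (M : manifold R n) (g : metric M) (psi : M -> N).
Hypothesis Cp : integral_C_parallel S g psi.
Variables (a : atlas M) (b : atlas N).
Implicit Types (x u v w : 'rV[R]_n).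

Let iso : isometric_immersion g h psi := Cp.1.1.

Local Notation f := (loc psi a b).
Local Notation U := (loc_dom psi a b).
Local Notation e_ i := (basis_vec R i).
Local Notation jac := (jac psi a b).
Local Notation hloc := (hloc h psi a b).
Local Notation Om := (conn_along h psi a b).
Local Notation Ga := (conn g a).
Local Notation hess := (hess h psi a b).
Local Notation sform := (sform g h psi a b).
Local Notation H := (mean_curvature (g a) (h b) f).
Local Notation X x := (xi S b (f x)).
Local Notation F x := (phi S b (f x)).

Let oU : open U.
Proof. exact: (loc_dom_open iso). Qed.

Let dX x : U x -> differentiable (fun y => X y) x.
Proof. by move=> Ux; apply: (differentiable_pull iso Ux); exact: vector_smooth. Qed.
Let dF x : U x -> differentiable (fun y => F y) x.
Proof. by move=> Ux; apply: (differentiable_pull iso Ux); exact: endo_smooth. Qed.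
Let dJ x : U x -> differentiable jac x.
Proof. exact: (differentiable_jac iso). Qed.
Let djac u x : U x -> differentiable (fun y => u *m jac y) x.
Proof. by move=> Ux; apply: differentiable_mulmx; [exact: differentiable_cst|exact: dJ]. Qed.

Let Djac u v x : U x -> 'D_u (fun y => v *m jac y) x + v *m jac x *m Om u x = v *m hess u x.
Proof.
move=> Ux; rewrite derive_mulmx; [|exact: differentiable_cst|exact: dJ].
by rewrite derive_cst mul0mx add0r mulmxDr mulmxA.
Qed.

Lemma derive_xi_loc u x : U x ->
  'D_u (fun y => X y) x + X x *m Om u x = - (u *m jac x *m F x).
Proof.
move=> Ux; rewrite (derive_pull iso u Ux (@vector_smooth _ _ _ (xi S) b)).
exact: (cov_xi sas _ (loc_img Ux)).
Qed.

Lemma jac_xi u x : U x -> inner (hloc x) (u *m jac x) (X x) = 0.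
Proof.
move=> Ux; rewrite (inner_xi S _ (loc_img Ux)) -(derive_loc iso _ Ux).
exact: Cp.1.2.
Qed.

Lemma hess_xi u v x : U x ->
  inner (hloc x) (v *m hess u x) (X x) = inner (hloc x) (v *m jac x) (u *m jac x *m F x).
Proof.
move=> Ux.
have := derive_inner iso u Ux (djac v Ux) (dX Ux).
rewrite (derive_near u oU Ux (G := cst 0)); last by move=> y Uy; exact: jac_xi.
rewrite derive_cst Djac// derive_xi_loc// inner_Nr => /eqP.
by rewrite eq_sym subr_eq0 => /eqP.
Qed.

(** By [hess_xi] this product equals the xi component of the Hessian, which is symmetric in [u] and
    [v], while skewness of phi makes it antisymmetric. *)
Lemma jac_phi u v x : U x -> inner (hloc x) (v *m jac x) (u *m jac x *m F x) = 0.
Proof.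
move=> Ux; have E := hess_xi u v Ux; have E' := hess_xi v u Ux.
rewrite (hess_sym iso u v Ux) E' in E.
have A : inner (hloc x) (u *m jac x) (v *m jac x *m F x)
    = - inner (hloc x) (u *m jac x *m F x) (v *m jac x).
  exact: inner_phir (loc_img Ux).
have := hloc_sym h (u *m jac x *m F x) (v *m jac x) Ux.
by lra.
Qed.

Lemma sform_xi u v x : U x -> inner (hloc x) (v *m sform u x) (X x) = 0.
Proof.
move=> Ux; rewrite mulmxBr inner_Bl hess_xi// jac_phi// mulmxA jac_xi// subrr.
by [].
Qed.

Lemma mean_curvature_xi x : U x -> inner (hloc x) (H x) (X x) = 0.
Proof.
move=> Ux; rewrite (mean_curvatureE iso Ux) inner_Zl /contract inner_suml big1 ?mulr0// => i _.
by rewrite inner_suml big1// => j _; rewrite inner_Zl sform_xi// mulr0.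
Qed.

(** Lets H be recovered from its products with phi(TM). It is used twice, in trace nabla^2 H and in
    the phi part of the curvature trace. *)
Lemma jac_phi_frame x (w : 'rV[R]_(n.*2.+1)) : U x ->
  (forall u, inner (hloc x) w (u *m jac x) = 0) -> inner (hloc x) w (X x) = 0 ->
  contract (invmx (g a x))
    (fun u v => inner (hloc x) w (v *m jac x *m F x) *: (u *m jac x *m F x)) = w.
Proof.
move=> Ux wJ wX; have ax := loc_dom_img Ux; have bx := loc_img Ux.
have gC := hloc_sym h _ _ Ux.
have FF p q : inner (hloc x) p (X x) = 0 ->
    inner (hloc x) (p *m F x) (q *m F x) = inner (hloc x) p q.
  by move=> pX; exact: inner_phi2.
have FX p : inner (hloc x) (p *m F x) (X x) = 0 by exact: inner_phi_xi.
have JX u := jac_xi u Ux; have JF u v := jac_phi u v Ux.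
have D0 p (u : 'rV_p) (v : 'rV_n) : (u *m (0 : 'M[R]_(p, n)) *m v^T) 0 0 = 0.
  by rewrite mulmx0 mul0mx mxE.
have D0' p (u : 'rV_p) (v : 'rV_1) : (u *m (0 : 'M[R]_(p, 1)) *m v^T) 0 0 = 0.
  by rewrite mulmx0 mul0mx mxE.
have rX (r : 'rV_1) : r *m X x = r 0 0 *: X x.
  by rewrite {1}[r]mx11_scalar mul_scalar_mx.
have rw (r : 'rV_1) : r *m w = r 0 0 *: w by rewrite {1}[r]mx11_scalar mul_scalar_mx.
have frame := @legendrian_frame R n (hloc x) (F x) (g a x) (jac x) (X x) w
  (metric_unit h bx) (metric_unit g ax).
have E : w = w *m hloc x *m (jac x *m F x)^T *m invmx (g a x) *m (jac x *m F x).
  apply: frame; apply: gram_eq => u v; rewrite ?D0 ?D0' ?mulmxA ?rX ?rw ?inner_Zl ?inner_Zr.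
  - by rewrite (inner_isometric iso).
  - by rewrite FF// (inner_isometric iso).
  - by rewrite (inner_xixi S bx) mulr1 mulmx1 [RHS]mxE big_ord1 mxE.
  - by rewrite JF.
  - by rewrite gC JF.
  - by rewrite JX mulr0.
  - by rewrite gC JX mulr0.
  - by rewrite FX mulr0.
  - by rewrite gC FX mulr0.
  - by rewrite wJ mulr0.
  - by rewrite wX !mulr0.
have gT : (invmx (g a x))^T = invmx (g a x).
  rewrite trmx_inv; congr invmx; apply/inner_symP => u v; exact: Defs.metric_sym.
have wE j : (w *m hloc x *m (jac x *m F x)^T) 0 j = inner (hloc x) w (e_ j *m jac x *m F x).
  rewrite /inner -(mulmxA (e_ j)) [(e_ j *m _)^T]trmx_mul mulmxA.
  by rewrite /basis_vec trmx_delta -colE [RHS]mxE.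
rewrite [RHS]E mulmx_sum_row; apply: eq_bigr => i _.
rewrite mxE scaler_suml; apply: eq_bigr => j _.
by rewrite scalerA wE rowE mulmxA -{1}gT mxE mulrC.
Qed.

(** The C-parallel condition on constant fields [v] and [w], whose covariant derivatives are the
    [Ga] terms. *)
Lemma normal_derive_sform u v w x : U x ->
  (w *m 'D_u (sform v) x + w *m sform v x *m Om u x) *m normal_proj g h psi a b x
  = w *m sform (v *m Ga u x) x + w *m Ga u x *m sform v x
    + inner (hloc x) (u *m jac x *m F x) (w *m sform v x) *: X x.
Proof.
move=> Ux; have ax := loc_dom_img Ux.
have := @Cp.2 a b (cst v) (cst w) (smooth_on_cst v) (smooth_on_cst w) x u Ux.
rewrite /cov_second_form /normal_conn (derive_loc iso _ Ux) (normal_partE iso _ Ux).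
rewrite (cov_along_conn iso _ _ Ux) !(cov_cst g _ _ ax) !(second_formE iso _ _ Ux).
rewrite (derive_near u oU Ux (G := fun y => w *m sform v y)); last first.
  by move=> y Uy; rewrite (second_formE iso _ _ Uy).
rewrite derive_mulmx; [|exact: differentiable_cst|exact: (differentiable_sform iso)].
rewrite derive_cst mul0mx add0r /cst.
have Z (p q r t : 'rV[R]_(n.*2.+1)) : p - q - r = t -> p = q + r + t.
  by move=> <-; mx_close.
exact: Z.
Qed.

Local Notation cH u x := ('D_u H x + H x *m Om u x).

(** The metric trace of [normal_derive_sform], since trace and covariant derivative commute. *)
Lemma normal_derive_mean_curvature u x : U x ->
  cH u x *m normal_proj g h psi a b x
  = inner (hloc x) (u *m jac x *m F x) (H x) *: X x.
Proof.
move=> Ux; set NP := normal_proj _ _ _ _ _ _.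
have sformNP v w : w *m sform v x *m NP = w *m sform v x.
  by apply: (normal_proj_id g Ux) => u'; exact: (sform_normal iso).
have sl w : linear (fun v => w *m sform v x).
  by move=> r v v'; rewrite !(sform_sym iso _ w Ux) mulmxDl -scalemxAl.
have sr v : linear (fun w => w *m sform v x).
  by move=> r w w'; rewrite mulmxDl -scalemxAl.
rewrite (derive_mean_curvature iso u Ux) {1}(mean_curvatureE iso Ux).
rewrite -scalemxAl -scalerDr -scalemxAl -addrA.
rewrite contract_mulmx -contractD mulmxDl !contract_mulmx.
under eq_contract => v w do rewrite sformNP.
under [Y in _ + Y]eq_contract => v w do rewrite (normal_derive_sform u v w Ux).
rewrite 2!contractD (contract_mul_l _ _ sl) (contract_mul_r _ _ sr).
rewrite addrA -!contractDm.
(* The derivative of the inverse metric cancels the connection terms coming from the two arguments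
   of the second fundamental form. *)
have -> (P Q : 'M[R]_n) : - (P + Q) + (Q + P) = 0 by mx_close.
rewrite contract0 add0r (mean_curvatureE iso Ux) inner_Zr -scalerA; congr (_ *: _).
rewrite inner_contract scaler_suml; apply: eq_bigr => i _; rewrite scaler_suml.
by apply: eq_bigr => j _; rewrite scalerA.
Qed.

Definition shape x : 'M[R]_n :=
  \matrix_(i, k) inner (hloc x) (e_ k *m sform (e_ i) x) (H x).

Lemma shape_form u v x : U x ->
  inner (shape x) u v = inner (hloc x) (v *m sform u x) (H x).
Proof.
move=> Ux; rewrite {1}[u]row_basis {1}[v]row_basis inner_suml.
rewrite (sform_sym iso u v Ux) {2}[u]row_basis mulmx_suml inner_suml.
apply: eq_bigr => i _; rewrite inner_Zl inner_sumr -scalemxAl inner_Zl; congr (_ * _).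
rewrite (sform_sym iso v _ Ux) {2}[v]row_basis mulmx_suml inner_suml.
by apply: eq_bigr => k _; rewrite inner_Zr -scalemxAl inner_Zl inner_basis mxE.
Qed.

Definition shape_mx x : 'M[R]_n := shape x *m invmx (g a x).

Lemma shape_opE v x : U x ->
  shape_op (g a) (h b) f x (H x) v = v *m shape_mx x.
Proof.
move=> Ux; rewrite /shape_op /raise mulmxA; congr (_ *m _); apply/rowP => k.
by rewrite mxE (second_formE iso _ _ Ux) -inner_row shape_form.
Qed.

Lemma inner_shape_mx u v x : U x ->
  inner (g a x) (u *m shape_mx x) v = inner (hloc x) (v *m sform u x) (H x).
Proof.
move=> Ux; rewrite -shape_form// inner_mul /shape_mx mulmxKV//.
exact: metric_unit (loc_dom_img Ux).
Qed.

Let dH x : U x -> differentiable H x.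
Proof. exact: (differentiable_mean_curvature iso). Qed.

(** The tangential part comes from differentiating the orthogonality of H and df(e_k). *)
Lemma derive_mean_curvature_eq u x : U x ->
  cH u x = inner (hloc x) (u *m jac x *m F x) (H x) *: X x - u *m shape_mx x *m jac x.
Proof.
move=> Ux; rewrite -normal_derive_mean_curvature// -mulNmx.
apply: (normal_decomposition (g := g) Ux) => k.
rewrite inner_Nl inner_shape_mx//.
have := derive_inner iso u Ux (dH Ux) (djac (e_ k) Ux).
rewrite (derive_near u oU Ux (G := cst 0)); last first.
  by move=> y Uy; exact: (mean_curvature_normal iso).
rewrite derive_cst Djac// => /eqP; rewrite eq_sym addr_eq0 => /eqP ->.
congr (- _); rewrite (hloc_sym h _ _ Ux).
rewrite -[hess u x](subrK (Ga u x *m jac x)) mulmxDr inner_Dl mulmxA.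
rewrite [Y in _ + Y](hloc_sym h _ _ Ux) (mean_curvature_normal iso _ Ux) addr0.
by [].
Qed.

Let dsform v w x : U x -> differentiable (fun y => w *m sform v y) x.
Proof.
move=> Ux; apply: differentiable_mulmx; first exact: differentiable_cst.
exact: (differentiable_sform iso).
Qed.

Lemma differentiable_shape x : U x -> differentiable shape x.
Proof.
move=> Ux; apply: differentiable_mx => i k; under eq_fun do rewrite mxE.
by apply: (differentiable_inner iso Ux); [exact: dsform|exact: dH].
Qed.

(** The form g(B(., .), H) is parallel: nabla^perp B points along xi and is orthogonal to H, while
    nabla H has only xi and tangential components and is orthogonal to B. *)
Lemma derive_shape u x : U x ->
  'D_u shape x = Ga u x *m shape x + shape x *m (Ga u x)^T.
Proof.
move=> Ux; apply/matrixP => i k.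
rewrite -inner_basis -[RHS]inner_basis inner_addG -inner_mul -inner_mulr.
rewrite inner_basis -(derive_entry u i k (differentiable_shape Ux)).
under eq_fun do rewrite mxE.
rewrite (derive_inner iso u Ux (dsform (e_ i) (e_ k) Ux) (dH Ux)).
rewrite derive_mulmx; [|exact: differentiable_cst|exact: (differentiable_sform iso)].
rewrite derive_cst mul0mx add0r !shape_form//.
have HJ v : inner (hloc x) (H x) (v *m jac x) = 0 by exact: (mean_curvature_normal iso).
rewrite -(inner_normal_proj g _ Ux HJ) normal_derive_sform//.
rewrite (derive_mean_curvature_eq u Ux) inner_Br inner_Zr (sform_xi _ _ Ux).
rewrite (sform_normal iso _ _ _ Ux) mulr0 subr0 addr0.
rewrite !inner_Dl inner_Zl [inner _ (X x) (H x)](hloc_sym h _ _ Ux) mean_curvature_xi//.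
by rewrite mulr0 addr0.
Qed.

Lemma differentiable_shape_mx x : U x -> differentiable shape_mx x.
Proof.
move=> Ux; apply: differentiable_mulmx; first exact: differentiable_shape.
exact: (differentiable_metric_inv iso Ux).
Qed.

Lemma derive_shape_mx u x : U x ->
  'D_u shape_mx x = Ga u x *m shape_mx x - shape_mx x *m Ga u x.
Proof.
move=> Ux.
rewrite (derive_mulmx u (differentiable_shape Ux) (differentiable_metric_inv iso Ux)).
rewrite derive_shape// (derive_metric_inv g u Ux) /shape_mx; mx_lin.
Qed.

Local Notation phiH v x := (inner (hloc x) (v *m jac x *m F x) (H x)).

Lemma differentiable_phiH v x : U x -> differentiable (fun y => phiH v y) x.
Proof.
move=> Ux; apply: (differentiable_inner iso Ux); last exact: dH.
by apply: differentiable_mulmx; [exact: djac|exact: dF].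
Qed.

(** The terms from nabla phi and nabla H drop out: H and phi(TM) are orthogonal to xi, phi(TM) is
    orthogonal to TM, and eta vanishes on TM. *)
Lemma derive_phiH u v x : U x -> 'D_u (fun y => phiH v y) x
  = inner (hloc x) (v *m sform u x *m F x) (H x) + phiH (v *m Ga u x) x.
Proof.
move=> Ux; have bx := loc_img Ux.
rewrite (derive_inner iso u Ux (differentiable_mulmx (djac v Ux) (dF Ux)) (dH Ux)).
rewrite derive_mean_curvature_eq// inner_Br inner_Zr.
rewrite [inner _ _ (X x)]inner_phi_xi// [inner _ _ (_ *m jac x)](hloc_sym h _ _ Ux).
rewrite jac_phi// mulr0 subr0 addr0 -inner_Dl.
rewrite (derive_mulmx u (djac v Ux) (dF Ux)).
rewrite (derive_pull iso u Ux (@endo_smooth _ _ _ (phi S) b)) (derive_phi sas _ bx).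
rewrite -[conn h b (u *m jac x) (f x)]/(Om u x).
have -> : 'D_u (fun y => v *m jac y) x = v *m hess u x - v *m jac x *m Om u x.
  by rewrite -(Djac u v Ux) addrK.
rewrite (eta_lower S bx) (mulmxBr (v *m jac x)) (mulmxDr (v *m jac x)) !row_outer.
rewrite [inner _ _ (X x)]jac_xi// scale0r subr0.
have -> : v *m hess u x = v *m sform u x + v *m Ga u x *m jac x.
  by rewrite mulmxBr mulmxA subrK.
have -> (p q r s : 'rV[R]_(n.*2.+1)) (O P : 'M[R]_(n.*2.+1)) :
    (p + q - r *m O) *m P + (r *m (O *m P - P *m O) + s) + r *m P *m O
    = p *m P + q *m P + s by mx_lin.
rewrite [LHS]inner_Dl inner_Zl [inner _ (X x) (H x)](hloc_sym h _ _ Ux).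
by rewrite mean_curvature_xi// mulr0 addr0.
Qed.

(** The left-hand side is (nabla^2 H)(u, v). As the shape operator of H is parallel, no tangential
    term survives even before tracing; the middle term on the right is nabla_u xi = - phi u. *)
Lemma derive2_mean_curvature u v x : U x ->
  differentiable (fun y => cH v y) x /\
  'D_u (fun y => cH v y) x + cH v x *m Om u x - cH (v *m Ga u x) x
  = inner (hloc x) (v *m sform u x *m F x) (H x) *: X x
    - phiH v x *: (u *m jac x *m F x) - v *m shape_mx x *m sform u x.
Proof.
move=> Ux.
have [d1 D1] := derive_scale_mx u (differentiable_phiH v Ux) (dX Ux).
have d2 : differentiable (fun y => v *m shape_mx y) x.
  by apply: differentiable_mulmx; [exact: differentiable_cst|exact: differentiable_shape_mx].
have D2 : 'D_u (fun y => v *m shape_mx y) x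
    = v *m (Ga u x *m shape_mx x - shape_mx x *m Ga u x).
  rewrite derive_mulmx; [|exact: differentiable_cst|exact: differentiable_shape_mx].
  by rewrite derive_cst mul0mx add0r derive_shape_mx.
have d3 := differentiable_mulmx d2 (dJ Ux).
have cHE w y : U y -> cH w y = phiH w y *: X y - w *m shape_mx y *m jac y.
  exact: derive_mean_curvature_eq.
split; first exact: (differentiable_on_eq oU Ux (cHE v) (differentiable_sub d1 d3)).
apply: (etrans (congr2 (fun p q => 'D_u (fun y => cH v y) x + p *m Om u x - q)
  (cHE v x Ux) (cHE (v *m Ga u x) x Ux))).
rewrite (derive_near u oU Ux (cHE v)) (derive_sub u d1 d3) D1 (derive_mulmx u d2 (dJ Ux)) D2.
rewrite (derive_phiH u v Ux).
have -> : 'D_u (fun y => X y) x = - (u *m jac x *m F x) - X x *m Om u x.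
  by rewrite -derive_xi_loc// addrK.
have -> : 'D_u jac x = sform u x + Ga u x *m jac x - jac x *m Om u x.
  by rewrite subrK addrK.
move: (phiH v x) (phiH _ x) (inner _ _ _) => p q r.
rewrite scalerDl !scalerDr !scalerN; mx_lin.
Qed.

End CParallel.

(** * The bitension field *)

Section Bitension.
Variables (R : realType) (n : nat) (c : R) (N : manifold R n.*2.+1) (h : metric N).
Variables (S : contact_metric h) (sf : sasakian_space_form S c).
Variables (M : manifold R n) (g : metric M) (psi : M -> N).
Hypothesis Cp : integral_C_parallel S g psi.
Hypothesis n_gt0 : (0 < n)%N.
Variables (a : atlas M) (b : atlas N).
Implicit Types (x u v w : 'rV[R]_n).

Let iso : isometric_immersion g h psi := Cp.1.1.
Let sas : sasakian S := sf.1.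

Local Notation f := (loc psi a b).
Local Notation U := (loc_dom psi a b).
Local Notation jac := (jac psi a b).
Local Notation hloc := (hloc h psi a b).
Local Notation Om := (conn_along h psi a b).
Local Notation sform := (sform g h psi a b).
Local Notation H := (mean_curvature (g a) (h b) f).
Local Notation tau := (tension (g a) (h b) f).
Local Notation X x := (xi S b (f x)).
Local Notation F x := (phi S b (f x)).
Local Notation cH u x := ('D_u H x + H x *m Om u x).
Local Notation shape_mx := (shape_mx h g psi a b).

Let oU : open U.
Proof. exact: (loc_dom_open iso). Qed.

Lemma invmx_metric_sym x : U x -> (invmx (g a x))^T = invmx (g a x).
Proof.
move=> Ux; rewrite trmx_inv; congr invmx; apply/inner_symP => u v.
exact: Defs.metric_sym (loc_dom_img Ux).
Qed.

Lemma cov_along_tension v x : U x ->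
  cov_along (h b) f v tau x = n%:R *: cH v x.
Proof.
move=> Ux; have dn : differentiable (cst (n%:R : R) : 'rV[R]_n -> R) x.
  exact: differentiable_cst.
rewrite (cov_along_conn iso _ _ Ux) (tensionE iso n_gt0 Ux).
rewrite (derive_near v oU Ux (G := fun y => n%:R *: H y)); last first.
  by move=> y; exact: (tensionE iso n_gt0).
have [_ ->] := derive_scale_mx v dn (differentiable_mean_curvature iso Ux).
by rewrite derive_cst scale0r add0r -scalemxAl -scalerDr.
Qed.

Lemma cov2_along_tension u v x : U x ->
  cov2_along (g a) (h b) f u v tau x
  = n%:R *: (inner (hloc x) (v *m sform u x *m F x) (H x) *: X x
    - inner (hloc x) (v *m jac x *m F x) (H x) *: (u *m jac x *m F x)
    - v *m shape_mx x *m sform u x).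
Proof.
move=> Ux; have dn : differentiable (cst (n%:R : R) : 'rV[R]_n -> R) x.
  exact: differentiable_cst.
have [d E] := derive2_mean_curvature sas Cp u v Ux.
rewrite -E /cov2_along (cov_along_conn iso _ _ Ux) (cov_cst g _ _ (loc_dom_img Ux)).
rewrite (cov_along_tension _ Ux).
rewrite (derive_near u oU Ux (G := fun y => n%:R *: cH v y)); last first.
  exact: cov_along_tension.
rewrite [cov_along _ _ _ _ x](cov_along_tension _ Ux).
have [_ ->] := derive_scale_mx u dn d.
by rewrite derive_cst scale0r add0r -scalemxAl -scalerDr -scalerBr.
Qed.

Lemma trace_cov2_along_tension x : U x ->
  mtrace (g a x) (fun u v => cov2_along (g a) (h b) f u v tau x)
  = n%:R *: (- H x - contract (invmx (g a x)) (fun u v => v *m shape_mx x *m sform u x)).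
Proof.
move=> Ux; have bx := loc_img Ux; rewrite mtraceE.
under eq_contract => u v do rewrite (cov2_along_tension u v Ux).
rewrite contractZ !contractD !contractN; congr (_ *: (_ - _)).
rewrite contract_scaler.
have -> : contract (invmx (g a x))
    ((fun u v => inner (hloc x) (v *m sform u x *m F x) (H x)) : _ -> _ -> R^o) = 0.
  (* The traced xi coefficient is n g(phi H, H), which vanishes because phi is skew. *)
  have : inner (hloc x) (H x *m F x) (H x) = 0.
    by rewrite hloc_sym// inner_phi_self.
  rewrite {1}(mean_curvatureE iso Ux) -scalemxAl inner_Zl contract_mulmx.
  move=> /eqP; rewrite mulf_eq0 invr_eq0 pnatr_eq0 (gtn_eqF n_gt0) => /eqP <-.
  rewrite hloc_sym// inner_contract; apply: eq_bigr => i _; apply: eq_bigr => j _.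
  by rewrite hloc_sym.
rewrite scale0r add0r; congr (- _).
(* What remains is the expansion of H in the frame phi df(e_i). *)
rewrite -[RHS](jac_phi_frame sas Cp Ux).
- by apply: eq_contract => u v; rewrite hloc_sym.
- by move=> u; exact: (mean_curvature_normal iso).
- exact: (mean_curvature_xi sas Cp).
Qed.

(** In the symmetrized curvature the metric part traces to (c + 3) n / 2. Each of the two phi terms
    reproduces the tension field by the frame expansion, with coefficient 3 (c - 1) / 4.
    Symmetrization costs a factor 1/2. *)
Lemma trace_curv_tension x : U x ->
  mtrace (g a x) (fun u v => curv (h b) (f x) ('D_u f x) (tau x) ('D_v f x))
  = - (((c + 3) * n%:R + 3 * (c - 1)) / 4) *: tau x.
Proof.
move=> Ux; have bx := loc_img Ux; have gT := invmx_metric_sym Ux.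
set T := fun u v => _.
have tJ u : inner (hloc x) (tau x) (u *m jac x) = 0.
  by rewrite (tensionE iso n_gt0 Ux) inner_Zl (mean_curvature_normal iso)// mulr0.
have tX : inner (hloc x) (tau x) (X x) = 0.
  by rewrite (tensionE iso n_gt0 Ux) inner_Zl (mean_curvature_xi sas Cp)// mulr0.
have flip (W : lmodType R) (T' : 'rV[R]_n -> 'rV[R]_n -> W) :
    contract (invmx (g a x)) (fun u v => T' v u) = contract (invmx (g a x)) T'.
  by rewrite -contract_tr gT.
(* The inverse metric is symmetric, so only the symmetrization of the integrand counts, and this is
   all that [space_form_curv] provides. *)
have TT (T' : 'rV[R]_n -> 'rV[R]_n -> 'rV[R]_(n.*2.+1)) : contract (invmx (g a x)) T'
    = 2^-1 *: contract (invmx (g a x)) (fun u v => T' u v + T' v u).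
  by rewrite contractD (flip _ T'); apply/rowP => k; mx_entries; field.
have E u v : T u v + T v u
    = - ((c + 3) / 2 * inner (g a x) u v) *: tau x
      - (3 * (c - 1) / 4) *: (inner (hloc x) (tau x) (v *m jac x *m F x) *: (u *m jac x *m F x)
         + inner (hloc x) (tau x) (u *m jac x *m F x) *: (v *m jac x *m F x)).
  rewrite -(inner_isometric iso _ _ Ux) !(hloc_sym h (tau x) _ Ux) /T !(derive_loc iso _ Ux).
  apply: (space_form_curv sf bx) => //.
  - exact: (jac_xi Cp).
  - exact: (jac_xi Cp).
  - by rewrite -(tJ u); exact: hloc_sym.
  - by rewrite -(tJ v); exact: hloc_sym.
  - exact: (jac_phi sas Cp).
have gI : contract (invmx (g a x))
      ((fun u v => - ((c + 3) / 2 * inner (g a x) u v)) : _ -> _ -> R^o)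
    = - ((c + 3) / 2 * n%:R).
  have trI : \sum_i \sum_j
      invmx (g a x) i j * inner (g a x) (basis_vec R i) (basis_vec R j) = n%:R.
    transitivity (\tr (1%:M : 'M[R]_n)); last by rewrite mxtrace1.
    rewrite -(mulVmx (metric_unit g (loc_dom_img Ux))); apply: eq_bigr => i _.
    rewrite mxE; apply: eq_bigr => j _.
    by rewrite (Defs.metric_sym g _ _ (loc_dom_img Ux)) inner_basis.
  rewrite -trI mulr_sumr -sumrN; apply: eq_bigr => i _.
  rewrite mulr_sumr -sumrN; apply: eq_bigr => j _.
  by rewrite /GRing.scale /=; ring.
have frame := jac_phi_frame sas Cp Ux tJ tX.
rewrite mtraceE (TT T) (eq_contract _ E).
rewrite contractD contractN contractZ contractD contract_scaler gI.
rewrite (flip _ (fun u v =>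
  inner (hloc x) (tau x) (v *m jac x *m F x) *: (u *m jac x *m F x))) frame.
by apply/rowP => k; mx_entries; field.
Qed.

Lemma bitension_C_parallel x : U x ->
  bitension (g a) (h b) f x = n%:R *: (((c * (n%:R + 3) + 3 * n%:R - 7) / 4) *: H x
    - mtrace (g a x) (fun u v => second_form (g a) (h b) f u
        (shape_op (g a) (h b) f x (H x) v) x)).
Proof.
move=> Ux; rewrite /bitension /rough_laplacian opprK.
rewrite trace_cov2_along_tension// trace_curv_tension// (tensionE iso n_gt0 Ux) mtraceE.
under [in RHS]eq_contract => u v do
  rewrite (shape_opE Cp _ Ux) (second_formE iso _ _ Ux).
move: (contract _ _) => B; apply/rowP => k; mx_entries; field.
by rewrite pnatr_eq0 -lt0n.
Qed.

End Bitension.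

(** * Positivity of the constant and conclusion *)

(** Gram-Schmidt by dimension count: for k < n the orthogonality conditions to k vectors have a
    nonzero solution, which is then normalized. Frames turn the traces into sums whose signs can be
    read off. *)
Lemma orthonormal_frame (R : realType) n (G : 'M[R]_n) k : (k <= n)%N ->
  (forall u v, inner G u v = inner G v u) -> (forall u, u != 0 -> 0 < inner G u u) ->
  exists X : 'M[R]_(k, n), X *m G *m X^T = 1%:M.
Proof.
move=> + sG pG; elim: k => [_|k IH kn].
  by exists 0; apply/matrixP => -[].
have [X XG] := IH (ltnW kn).
have [u u0 uX] : exists2 u : 'rV_n, u != 0 & u *m G *m X^T = 0.
  have K0 : kermx (G *m X^T) != 0.
    rewrite -mxrank_eq0 mxrank_ker subn_eq0 -ltnNge.
    exact: leq_ltn_trans (rank_leq_col _) kn.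
  have /rowV0Pn[u uK u0] := K0; exists u => //.
  by rewrite -mulmxA; exact/sub_kermxP.
pose s := Num.sqrt (inner G u u).
have s0 : 0 < s by rewrite sqrtr_gt0 pG.
have uu : u *m G *m u^T = (s * s)%:M.
  by rewrite [LHS]mx11_scalar -expr2 sqr_sqrtr// ltW// pG.
have Xu : X *m G *m u^T = 0.
  by apply: trmx_inj; rewrite !trmx_mul trmxK trmx0 mulmxA ((inner_symP G).1 sG) uX.
rewrite -addn1; exists (col_mx X (s^-1 *: u)).
rewrite tr_col_mx mul_col_mx mul_col_row XG trmxZ -!scalemxAl -!scalemxAr Xu uX uu.
rewrite !scaler0 scalar_mx_block; congr block_mx.
rewrite !scale_scalar_mx; congr (_%:M); field.
by rewrite gt_eqF.
Qed.

(** Orthonormality of the rows of [X] means that the inverse of [G] is X^T X, and each factor can be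
    moved into one argument of [T]. *)
Lemma contract_frame (R : realType) n (W : lmodType R) (G X : 'M[R]_n)
    (T : 'rV[R]_n -> 'rV[R]_n -> W) : X *m G *m X^T = 1%:M ->
  (forall v, linear (T ^~ v)) -> (forall u, linear (T u)) ->
  contract (invmx G) T = \sum_k T (row k X) (row k X).
Proof.
move=> XG Tl Tr.
have uX : X \in unitmx.
  by have := unitmx1 R n; rewrite -XG !unitmx_mul => /andP[/andP[]].
have GX : G *m X^T = invmx X.
  by rewrite -[LHS](mulKmx uX) (mulmxA X) XG mulmx1.
have uG : G \in unitmx.
  by have := unitmx1 R n; rewrite -XG !unitmx_mul => /andP[/andP[]].
have -> : invmx G = X^T *m (1%:M *m X).
  by rewrite mul1mx -[LHS]mulmx1 -(mulVmx uX) -GX !mulmxA mulVmx// mul1mx.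
rewrite -(contract_mul_l _ _ Tl) -(contract_mul_r _ _ (fun u => Tr (u *m X))).
rewrite /contract; apply: eq_bigr => i _; rewrite (bigD1 i)//= big1 => [|j ji].
  by rewrite addr0 mxE eqxx scale1r -rowE.
by rewrite mxE eq_sym (negPf ji) scale0r.
Qed.

(* Pairing the equation with H gives [k |H|^2 = |A_H|^2], and A_H is not zero because
   its trace is [n |H|^2]. *)
Lemma trace_equation_bound (R : realType) (n : nat) (c : R)
    (N : manifold R n.*2.+1) (h : metric N) (S : contact_metric h)
    (M : manifold R n) (g : metric M) (psi : M -> N) (a : atlas M) (b : atlas N) x :
  integral_C_parallel S g psi -> loc_dom psi a b x ->
  let H := mean_curvature (g a) (h b) (loc psi a b) in
  H x != 0 ->
  mtrace (g a x) (fun u v => second_form (g a) (h b) (loc psi a b) u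
    (shape_op (g a) (h b) (loc psi a b) x (H x) v) x)
  = ((c * (n%:R + 3) + 3 * n%:R - 7) / 4) *: H x ->
  (7 - 3 * n%:R) / (n%:R + 3) < c.
Proof.
move=> Cp Ux H Hx; set k := _ / 4 => trE; have iso := Cp.1.1.
have ax := loc_dom_img Ux; have bx := loc_img Ux.
pose A := shape_mx h g psi a b x; pose B u := sform g h psi a b u x.
have gA u v : inner (g a x) (u *m A) v = inner (hloc h psi a b x) (v *m B u) (H x).
  exact: (inner_shape_mx Cp).
have [X XG] := orthonormal_frame (leqnn n)
  (fun u v => Defs.metric_sym g u v ax) (fun u => @metric_pos _ _ _ g a x u ax).
have HH : 0 < inner (hloc h psi a b x) (H x) (H x) by exact: metric_pos.
have Bl (v : 'rV[R]_n) : linear (fun u : 'rV[R]_n => v *m B u).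
  by move=> r u u'; rewrite /B !(sform_sym iso _ v Ux) mulmxDl -scalemxAl.
have Br (u : 'rV[R]_n) : linear (fun v : 'rV[R]_n => v *m B u).
  by move=> r v v'; rewrite mulmxDl -scalemxAl.
have BA (u : 'rV[R]_n) : linear (fun v : 'rV[R]_n => v *m A *m B u).
  by move=> r v v'; rewrite !mulmxDl -!scalemxAl.
have kHH : k * inner (hloc h psi a b x) (H x) (H x)
    = \sum_i inner (g a x) (row i X *m A) (row i X *m A).
  rewrite -inner_Zl -trE mtraceE.
  under eq_contract => u v do rewrite (shape_opE Cp _ Ux) (second_formE iso _ _ Ux).
  rewrite (contract_frame XG (fun v => Bl (v *m A)) BA) inner_suml.
  by apply: eq_bigr => i _; rewrite gA.
(* For n = 0 the factor [n%:R^-1] is 0 by convention, so [H x] would vanish. *)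
have n_gt0 : (0 < n)%N.
  case: posnP => // n0; move: Hx.
  by rewrite /H /mean_curvature [in n%:R]n0 invr0 scale0r eqxx.
have n0 : n%:R != 0 :> R by rewrite pnatr_eq0 -lt0n.
have nHH : n%:R * inner (hloc h psi a b x) (H x) (H x)
    = \sum_i inner (g a x) (row i X *m A) (row i X).
  rewrite -inner_Zl {1}/H (mean_curvatureE iso Ux) scalerA divff// scale1r.
  rewrite (contract_frame XG Bl Br) inner_suml.
  by apply: eq_bigr => i _; rewrite gA.
have g_ge0 u : 0 <= inner (g a x) u u.
  by have [->|u0] := eqVneq u 0; [rewrite inner_0l|rewrite ltW// metric_pos].
have k_gt0 : 0 < k.
  rewrite -(pmulr_lgt0 _ HH) kHH lt0r sumr_ge0 ?andbT => [|i _]; last exact: g_ge0.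
  apply/eqP => /eqP; rewrite psumr_eq0 => [/allP z|i _]; last exact: g_ge0.
  move: nHH; rewrite big1 => [/eqP|i _].
    by rewrite mulf_eq0 (negPf n0) gt_eqF.
  have [->|Ai] := eqVneq (row i X *m A) 0; first exact: inner_0l.
  have /eqP Z := z i (mem_index_enum i).
  by have := metric_pos g ax Ai; rewrite Z ltxx.
rewrite ltr_pdivrMr; last by rewrite ltr_wpDl.
by move: k_gt0; rewrite /k; lra.
Qed.

Theorem proposition3p6 (R : realType) (n : nat) (c : R)
    (N : manifold R n.*2.+1) (h : metric N) (S : contact_metric h)
    (space_form : sasakian_space_form S c)
    (M : manifold R n) (g : metric M) (psi : M -> N)
    (C_parallel : integral_C_parallel S g psi)
    (non_minimal : ~ minimal g h psi) :
  proper_biharmonic g h psi <->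
    (7 - 3 * n%:R) / (n%:R + 3) < c /\
    forall a b x, loc_dom psi a b x ->
      let H := mean_curvature (g a) (h b) (loc psi a b) in
      mtrace (g a x)
        (fun u v => second_form (g a) (h b) (loc psi a b) u
          (shape_op (g a) (h b) (loc psi a b) x (H x) v) x)
      = ((c * (n%:R + 3) + 3 * n%:R - 7) / 4) *: H x.
Proof.
have iso := C_parallel.1.1.
(* By the same convention on the inverse of 0, a 0-dimensional M counts as minimal. *)
have n_gt0 : (0 < n)%N.
  case: n => [|//] in c N h S space_form M g psi C_parallel non_minimal iso *.
  by case: non_minimal => a b x _; rewrite /mean_curvature invr0 scale0r.
have n0 : n%:R != 0 :> R by rewrite pnatr_eq0 -lt0n.
have tauE a b x : loc_dom psi a b x -> _ = _ := tensionE iso n_gt0.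
have bitE a b x (Ux : loc_dom psi a b x) :=
  bitension_C_parallel space_form C_parallel n_gt0 Ux.
(* The tension field is n H with n nonzero, so a harmonic inclusion would be minimal, and biharmonic
   already implies proper-biharmonic here. *)
have nharm : ~ Defs.harmonic g h psi.
  move=> [_ harm]; apply: non_minimal => a b x Ux; apply/eqP.
  by have /eqP := harm a b x Ux; rewrite tauE// scaler_eq0 (negPf n0).
split=> [[[_ bih] _]|[_ trE]].
- have trE a b x : loc_dom psi a b x ->
      let H := mean_curvature (g a) (h b) (loc psi a b) in
      mtrace (g a x)
        (fun u v => second_form (g a) (h b) (loc psi a b) u
          (shape_op (g a) (h b) (loc psi a b) x (H x) v) x)
      = ((c * (n%:R + 3) + 3 * n%:R - 7) / 4) *: H x.
    move=> Ux /=; have /eqP := bih a b x Ux.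
    by rewrite (bitE _ _ _ Ux) scaler_eq0 (negPf n0) subr_eq0 => /eqP ->.
  split=> //.
  (* The bound on [c] is a condition on constants, so it can be read off at a single point where H
     does not vanish. *)
  have [a [b [x [Ux Hx]]]] : exists a b x, loc_dom psi a b x /\
      mean_curvature (g a) (h b) (loc psi a b) x != 0.
    apply/not_existsP => nex; apply: non_minimal => a b x Ux.
    by apply/eqP; apply: contraT => Hx; case: (nex a); exists b, x.
  exact: (trace_equation_bound C_parallel Ux Hx (trE a b x Ux)).
- split=> //; split; first exact: iso.1.
  move=> a b x Ux; rewrite (bitE _ _ _ Ux) trE// subrr scaler0.
  by [].
Qed.
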